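(* Let $\Lambda$ be an Auslander algebra such that there are only finitely many isomorphism classes of basic tilting $\Lambda$-modules and only finitely many isomorphism classes of basic tilting $\Lambda^{op}$-modules. If every indecomposable $\tau$-rigid $\Lambda$-module $M$ with $\mathrm{pd}_{\Lambda}M=2$ is of grade $2$, then $\Lambda$ is $\tau$-tilting finite.
   Context: All algebras are basic connected finite-dimensional algebras over an algebraically closed field $K$, and all modules are finitely generated right modules. $\Lambda^{op}$ is the opposite algebra. An algebra $\Lambda$ is an Auslander algebra if $\mathrm{gl.dim}\,\Lambda\le 2$ and $I_i(\Lambda)$ is projective for $i=0,1$, where $I_i(\Lambda)$ is the $(i+1)$-th term in a minimal injective resolution of $\Lambda$; equivalently, $\Lambda=\mathrm{End}_R(A)$ for a representation-finite algebra $R$ and an additive generator $A$ of the category of finitely generated $R$-modules. $|M|$ is the number of pairwise non-isomorphic indecomposable direct summands of $M$; $M$ is basic if its indecomposable direct summands are pairwise non-isomorphic. A $\Lambda$-module $T$ is a (classical) tilting module if $\mathrm{pd}_\Lambda T\le 1$, $\mathrm{Ext}^1_\Lambda(T,T)=0$ and $|T|=|\Lambda|$. Let $\tau$ be the Auslander–Reiten translation; $M$ is $\tau$-rigid if $\mathrm{Hom}_\Lambda(M,\tau M)=0$. For an integer $i\ge1$, $\mathrm{grade}\,M\ge i$ means $\mathrm{Ext}^j_\Lambda(M,\Lambda)=0$ for $0\le j\le i-1$; $M$ is of grade $2$ if $\mathrm{grade}\,M\ge2$ and $\mathrm{Ext}^2_\Lambda(M,\Lambda)\ne0$. $\Lambda$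 is $\tau$-tilting finite if there are only finitely many isomorphism classes of indecomposable $\tau$-rigid $\Lambda$-modules. *)

(* Defs.v *)
From HB Require Import structures.
From mathcomp Require Import all_boot all_algebra all_field.

Set Implicit Arguments.
Unset Strict Implicit.
Unset Printing Implicit Defensive.

Import GRing.Theory.
Local Open Scope ring_scope.

(** The opposite algebra: the library's converse ring [A^c], with the linear
    structure of [A]. *)
Section OppositeAlgebra.
Variables (K : fieldType) (A : falgType K).

HB.instance Definition _ := Vector.on A^c.

Fact converse_scalerAl (k : K) (a b : A^c) :
  k *: (a * b : A^c) = (k *: a : A^c) * b :> A^c.
Proof. exact: (@scalerAr _ A k b a). Qed.
HB.instance Definition _ :=
  GRing.Lmodule_isLalgebra.Build K A^c converse_scalerAl.

Fact converse_scalerAr (k : K) (a b : A^c) :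
  k *: (a * b : A^c) = a * (k *: b : A^c) :> A^c.
Proof. exact: (@scalerAl _ A k b a). Qed.
HB.instance Definition _ :=
  GRing.Lalgebra_isAlgebra.Build K A^c converse_scalerAr.

End OppositeAlgebra.

(** Finitely generated right [A]-modules.  As [A] is finite dimensional over
    [K], these are the right [A]-modules of finite dimension over [K]; left
    [A]-modules are the objects of [rmod A^c]. *)
Record rmod (K : fieldType) (A : falgType K) := RMod {
  rmod_carrier :> vectType K;
  ract : rmod_carrier -> A -> rmod_carrier;
  ract_linearl : forall a, linear (ract^~ a);
  ract_linearr : forall x, linear (ract x);
  ract1 : forall x, ract x 1 = x;
  ractM : forall x a b, ract x (a * b) = ract (ract x a) b
}.

Section Homomorphisms.
Variables (K : fieldType) (A : falgType K).
Implicit Types (M N P I : rmod A) (a : A).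

Definition ractr M a (x : M) : M := ract x a.
HB.instance Definition _ M a :=
  GRing.isLinear.Build K M M *:%R (@ractr M a) (@ract_linearl K A M a).

Definition ractl M (x : M) a : M := ract x a.
HB.instance Definition _ M x :=
  GRing.isLinear.Build K A M *:%R (@ractl M x) (@ract_linearr K A M x).

Definition actr M a : 'End(M) := linfun (@ractr M a).

Lemma actrE M a x : actr M a x = ract x a.
Proof. by rewrite lfunE. Qed.

(** [f |-> (x |-> f (x a) - f(x) a)] *)
Definition hom_defect M N a (f : 'Hom(M, N)) : 'Hom(M, N) :=
  ((f \o actr M a) - (actr N a \o f))%VF.

Fact hom_defect_is_linear M N a : linear (@hom_defect M N a).
Proof.
move=> k f g; rewrite /hom_defect comp_lfunDl comp_lfunDr -comp_lfunZl.
by rewrite -comp_lfunZr opprD addrACA -scalerBr.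
Qed.
HB.instance Definition _ M N a :=
  GRing.isLinear.Build K 'Hom(M, N) 'Hom(M, N) *:%R (@hom_defect M N a)
    (@hom_defect_is_linear M N a).

(** Hom_A(M, N), as a subspace of the space of [K]-linear maps. *)
Definition homv M N : {vspace 'Hom(M, N)} :=
  (\bigcap_(i < \dim {:A}) lker (linfun (@hom_defect M N (vbasis {:A})`_i)))%VS.

Lemma homvP M N (f : 'Hom(M, N)) :
  reflect (forall x a, f (ract x a) = ract (f x) a) (f \in homv M N).
Proof.
rewrite memvE /homv; apply: (iffP subv_bigcapP) => [ker_f x a | hom_f i _].
  rewrite -[LHS]/(f (ractl x a)) -[RHS]/(ractl (f x) a).
  rewrite (coord_vbasis (memvf a)) !linear_sum.
  apply: eq_bigr => i _; rewrite !linearZ /=; congr (_ *: _).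
  have := ker_f i isT; rewrite -memvE memv_ker lfunE => /eqP/lfunP/(_ x).
  rewrite /= /hom_defect add_lfunE opp_lfunE !comp_lfunE !actrE zero_lfunE.
  by move/subr0_eq.
rewrite -memvE memv_ker lfunE; apply/eqP/lfunP => x.
rewrite /= /hom_defect add_lfunE opp_lfunE !comp_lfunE !actrE zero_lfunE.
by rewrite hom_f subrr.
Qed.

Definition iso M N := exists2 f : 'Hom(M, N), f \in homv M N & bijective f.

Definition is_zero M := forall x : M, x = 0.

Definition submod M (U : {vspace M}) := forall x a, x \in U -> ract x a \in U.

Definition essential M (U : {vspace M}) :=
  forall V : {vspace M}, submod V -> (U :&: V = 0)%VS -> V = 0%VS.

Definition superfluous M (U : {vspace M}) :=
  forall V : {vspace M}, submod V -> (U + V = fullv)%VS -> V = fullv.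

Definition projective P : Prop :=
  forall M N (g : 'Hom(M, N)) (f : 'Hom(P, N)),
    g \in homv M N -> limg g = fullv -> f \in homv P N ->
  exists2 h, h \in homv P M & (g \o h)%VF = f.

Definition injective_mod I :=
  forall M N (g : 'Hom(M, N)) (f : 'Hom(M, I)),
    g \in homv M N -> lker g = 0%VS -> f \in homv M I ->
  exists2 h, h \in homv N I & (h \o g)%VF = f.

End Homomorphisms.

Section Constructions.
Variables (K : fieldType) (A : falgType K).

Fact regular_linearl (a : A) : linear (fun x : A => x * a).
Proof. by move=> k x y; rewrite mulrDl scalerAl. Qed.

Fact regular_linearr (x : A) : linear (fun a : A => x * a).
Proof. by move=> k a b; rewrite mulrDr scalerAr. Qed.

Definition regular : rmod A :=
  @RMod K A A (fun x a => x * a) regular_linearl regular_linearr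
    (@mulr1 A) (@mulrA A).

Fact zero_mod_eq (x y : 'rV[K]_0) : x = y.
Proof. by rewrite (thinmx0 x) (thinmx0 y). Qed.

Definition zero_mod : rmod A :=
  @RMod K A 'rV[K]_0 (fun x _ => x) (fun _ _ _ _ => zero_mod_eq _ _)
    (fun _ _ _ _ => zero_mod_eq _ _) (fun _ => zero_mod_eq _ _)
    (fun _ _ _ => zero_mod_eq _ _).

Section DirectSum.
Variables M N : rmod A.

Definition dsum_act (x : M * N) (a : A) : M * N := (ract x.1 a, ract x.2 a).

Fact dsum_linearl a : linear (dsum_act^~ a).
Proof.
by move=> k [x x'] [y y']; congr (_, _); apply: (ract_linearl a).
Qed.

Fact dsum_linearr x : linear (dsum_act x).
Proof. by move=> k a b; congr (_, _); apply: ract_linearr. Qed.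

Fact dsum_act1 x : dsum_act x 1 = x.
Proof. by case: x => x x'; rewrite /dsum_act !ract1. Qed.

Fact dsum_actM x a b : dsum_act x (a * b) = dsum_act (dsum_act x a) b.
Proof. by rewrite /dsum_act !ractM. Qed.

Definition dsum : rmod A :=
  @RMod K A (M * N)%type dsum_act dsum_linearl dsum_linearr dsum_act1 dsum_actM.

End DirectSum.

(** The left module Hom_A(M, A), with (a f)(x) = a f(x). *)
Section Star.
Variable M : rmod A.
Let H := homv M regular.

Definition star_act (f : subvs_of H) (a : A^c) : subvs_of H :=
  vsproj H (amull (a : A) \o (vsval f : 'Hom(M, A)))%VF.

Definition star_val (f : subvs_of H) : 'Hom(M, A) := vsval f.

Fact star_actE f a x : star_val (star_act f a) x = (a : A) * star_val f x.
Proof.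
rewrite /star_val vsprojK; first by rewrite comp_lfunE lfunE.
apply/homvP => y b; rewrite !comp_lfunE !lfunE /=.
by rewrite [vsval f _](homvP _ (subvsP f) y b) /= mulrA.
Qed.

Fact star_ext f g : star_val f =1 star_val g -> f = g.
Proof. by move=> eq_fg; apply/val_inj/lfunP. Qed.

Fact star_valP k f g x :
  star_val (k *: f + g) x = k *: star_val f x + star_val g x.
Proof. by rewrite /star_val linearP /= add_lfunE scale_lfunE. Qed.

Fact star_linearl a : linear (star_act^~ a).
Proof.
move=> k f g; apply: star_ext => x.
by rewrite star_valP !star_actE star_valP mulrDr scalerAr.
Qed.

Fact star_linearr f : linear (star_act f).
Proof.
move=> k a b; apply: star_ext => x.
by rewrite star_valP !star_actE -[RHS]/(_ + _ : A) scalerAl -mulrDl.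
Qed.

Fact star_act1 f : star_act f 1 = f.
Proof. by apply: star_ext => x; rewrite star_actE; apply: mul1r. Qed.

Fact star_actM f a b : star_act f (a * b) = star_act (star_act f a) b.
Proof. by apply: star_ext => x; rewrite !star_actE mulrA. Qed.

Definition star : rmod A^c :=
  @RMod K A^c (subvs_of H) star_act star_linearl star_linearr star_act1 star_actM.

End Star.

(** The [K]-dual of a left module, with (f a)(x) = f(a x). *)
Section Dual.
Variable M : rmod A^c.

Definition kdual_act (f : 'Hom(M, K^o)) (a : A) : 'Hom(M, K^o) :=
  (f \o actr M (a : A^c))%VF.

Fact kdual_actE f a x : kdual_act f a x = f (ract x (a : A^c)).
Proof. by rewrite comp_lfunE actrE. Qed.

Fact kdual_linearl a : linear (kdual_act^~ a).
Proof.
move=> k f g; apply/lfunP => x.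
by rewrite add_lfunE scale_lfunE !kdual_actE add_lfunE scale_lfunE.
Qed.

Fact kdual_linearr f : linear (kdual_act f).
Proof.
move=> k a b; apply/lfunP => x; rewrite add_lfunE scale_lfunE !kdual_actE.
by rewrite -linearP -(ract_linearr x).
Qed.

Fact kdual_act1 f : kdual_act f 1 = f.
Proof.
by apply/lfunP => x; rewrite kdual_actE; congr (f _); apply: (ract1 x).
Qed.

Fact kdual_actM f a b : kdual_act f (a * b) = kdual_act (kdual_act f a) b.
Proof.
apply/lfunP => x; rewrite !kdual_actE; congr (f _).
exact: (ractM x (b : A^c) (a : A^c)).
Qed.

Definition kdual : rmod A :=
  @RMod K A 'Hom(M, K^o) kdual_act kdual_linearl kdual_linearr kdual_act1 kdual_actM.

End Dual.

End Constructions.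

Arguments regular {K} A.
Arguments zero_mod {K A}.

Section Decompositions.
Variables (K : fieldType) (A : falgType K).
Implicit Types (M N X Y : rmod A).

Definition summand X M := exists Y, iso M (dsum X Y).

Definition indecomposable M :=
  ~ is_zero M /\ forall X Y, iso M (dsum X Y) -> is_zero X \/ is_zero Y.

(** The indecomposable direct summands in a (Krull-Schmidt) decomposition of
    [M] are pairwise non-isomorphic. *)
Definition basic M := exists n (X : 'I_n -> rmod A),
  [/\ forall i, indecomposable (X i),
      forall i j, iso (X i) (X j) -> i = j &
      iso M (\big[@dsum K A/zero_mod]_(i < n) X i)].

(** |M| = n *)
Definition nb_summands M n := exists X : 'I_n -> rmod A,
  [/\ forall i, indecomposable (X i) /\ summand (X i) M,
      forall i j, iso (X i) (X j) -> i = j &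
      forall Y, indecomposable Y -> summand Y M -> exists i, iso Y (X i)].

Definition finitely_many_classes (P : rmod A -> Prop) :=
  exists n (X : 'I_n -> rmod A), forall M, P M -> exists i, iso M (X i).

End Decompositions.

Section HomologicalAlgebra.
Variables (K : fieldType) (A : falgType K).
Implicit Types (M N : rmod A).

(** ... -> P 1 -> P 0 -> M -> 0 *)
Record proj_resolution M := ProjResolution {
  pres_obj :> nat -> rmod A;
  pres_d : forall i, 'Hom(pres_obj i.+1, pres_obj i);
  pres_aug : 'Hom(pres_obj 0%N, M);
  pres_projective : forall i, projective (pres_obj i);
  pres_d_hom : forall i, pres_d i \in homv (pres_obj i.+1) (pres_obj i);
  pres_aug_hom : pres_aug \in homv (pres_obj 0%N) M;
  pres_aug_surj : limg pres_aug = fullv;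
  pres_exact0 : limg (pres_d 0%N) = lker pres_aug;
  pres_exact : forall i, limg (pres_d i.+1) = lker (pres_d i)
}.

(** 0 -> M -> I 0 -> I 1 -> ..., where M -> I 0 and
    coker (I (i - 1) -> I i) = im (I i -> I i.+1) -> I i.+1 are injective
    envelopes. *)
Record min_inj_resolution M := MinInjResolution {
  ires_obj :> nat -> rmod A;
  ires_d : forall i, 'Hom(ires_obj i, ires_obj i.+1);
  ires_aug : 'Hom(M, ires_obj 0%N);
  ires_injective : forall i, injective_mod (ires_obj i);
  ires_d_hom : forall i, ires_d i \in homv (ires_obj i) (ires_obj i.+1);
  ires_aug_hom : ires_aug \in homv M (ires_obj 0%N);
  ires_aug_inj : lker ires_aug = 0%VS;
  ires_exact0 : limg ires_aug = lker (ires_d 0%N);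
  ires_exact : forall i, limg (ires_d i) = lker (ires_d i.+1);
  ires_min0 : essential (limg ires_aug);
  ires_min : forall i, essential (limg (ires_d i))
}.

Definition pd_le M n :=
  exists P : proj_resolution M, forall i, (n < i)%N -> is_zero (P i).

Definition pd_eq M n := pd_le M n /\ forall m, pd_le M m -> (n <= m)%N.

Definition cocycle M N (P : proj_resolution M) i (f : 'Hom(P i, N)) :=
  f \in homv (P i) N /\ (f \o pres_d P i)%VF = 0.

Definition coboundary M N (P : proj_resolution M) i : 'Hom(P i, N) -> Prop :=
  match i with
  | 0%N => fun f => f = 0
  | j.+1 => fun f => exists2 g, g \in homv (P j) N & f = (g \o pres_d P j)%VF
  end.

(** Ext^i(M, N) = H^i(Hom_A(P, N)) vanishes.  Up to isomorphism this cohomology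
    does not depend on the projective resolution [P] of [M], and [M] has one. *)
Definition Ext_vanishes i M N :=
  exists P : proj_resolution M,
    forall f : 'Hom(P i, N), cocycle f -> coboundary f.

Definition grade_ge M i :=
  forall j, (j < i)%N -> Ext_vanishes j M (regular A).

Definition of_grade2 M := grade_ge M 2 /\ ~ Ext_vanishes 2 M (regular A).

Definition tilting T :=
  [/\ pd_le T 1, Ext_vanishes 1 T T &
      exists2 n, nb_summands T n & nb_summands (regular A) n].

(** A minimal projective presentation P1 -> P0 -> M -> 0: both P0 -> M and
    P1 -> ker (P0 -> M) are projective covers. *)
Record min_proj_presentation M := MinProjPresentation {
  mpp1 : rmod A;
  mpp0 : rmod A;
  mpp_d : 'Hom(mpp1, mpp0);
  mpp_aug : 'Hom(mpp0, M);
  mpp1_projective : projective mpp1;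
  mpp0_projective : projective mpp0;
  mpp_d_hom : mpp_d \in homv mpp1 mpp0;
  mpp_aug_hom : mpp_aug \in homv mpp0 M;
  mpp_aug_surj : limg mpp_aug = fullv;
  mpp_exact : limg mpp_d = lker mpp_aug;
  mpp_aug_min : superfluous (lker mpp_aug);
  mpp_d_min : superfluous (lker mpp_d)
}.

(** [T] is the transpose of [M]: there is an exact sequence
    P0^* -> P1^* -> T -> 0 for a minimal projective presentation of [M]. *)
Definition is_transpose M (T : rmod A^c) :=
  exists (p : min_proj_presentation M) (q : 'Hom(star (mpp1 p), T)),
    [/\ q \in homv (star (mpp1 p)) T,
        limg q = fullv &
        forall f : star (mpp1 p), q f = 0 <->
          exists g : star (mpp0 p), star_val f = (star_val g \o mpp_d p)%VF].

(** [N] is tau M = D Tr M, which is determined up to isomorphism. *)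
Definition is_tau M N :=
  exists2 T : rmod A^c, is_transpose M T & iso N (kdual T).

Definition tau_rigid M := exists2 N, is_tau M N & homv M N = 0%VS.

End HomologicalAlgebra.

Section Algebras.
Variables (K : fieldType) (A : falgType K).

Definition basic_algebra := basic (regular A).

(** [A] is not a product of two nonzero algebras. *)
Definition connected_algebra :=
  forall e : A, e * e = e -> (forall a, a * e = e * a) -> e = 0 \/ e = 1.

Definition auslander_algebra :=
  (forall M : rmod A, pd_le M 2) /\
  (exists I : min_inj_resolution (regular A),
     projective (I 0%N) /\ projective (I 1%N)).

Definition tau_tilting_finite :=
  finitely_many_classes (fun M : rmod A => indecomposable M /\ tau_rigid M).

End Algebras.

(* Main.v *)
Require Import Defs.
From HB Require Import structures.
From mathcomp Require Import all_boot all_algebra all_field.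
From Stdlib Require Import Classical.

Set Implicit Arguments.
Unset Strict Implicit.
Unset Printing Implicit Defensive.

Import GRing.Theory.
Local Open Scope ring_scope.

(** Let [M] be indecomposable and tau-rigid with minimal presentation
    [P1 -> P0 -> M -> 0] and transpose [T].  The vanishing of [Hom(M, D T)] makes
    both [Hom(P0, M) -> Hom(P1, M)] and [Hom(P1^*, T) -> Hom(P0^*, T)] onto.
    If [pd M <= 1], the first says that [M] is rigid, so [M] is a summand of a
    tilting module (Bongartz).  If [pd M = 2], then [Hom(M, A) = 0] by the grade
    hypothesis, so [0 -> P0^* -> P1^* -> T -> 0] is exact; the second then says that
    [T] is an indecomposable rigid left module with [pd T <= 1], hence a summand of a
    tilting module, and [M] is recovered as [Ext^1(T, A)].  Krull-Schmidt leaves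
    finitely many classes in both cases.

    For Bongartz's completion of [M], the number of its indecomposable summands
    is that of [A] because their classes form a basis of the Grothendieck group of
    projectives: they generate it by the universal extensions
    [0 -> P -> E -> M^k -> 0], and they are independent because suitable test
    modules separate them under the Euler form. *)

(** Both surjectivity statements come from one space. $\mathrm{Hom}(M, DT)$ is the $K$-dual of $M
    \otimes_A T$, and right exactness presents $M \otimes_A T$ both as the cokernel of
    $\mathrm{Hom}(P_0, M) \to \mathrm{Hom}(P_1, M)$ and as the cokernel of $\mathrm{Hom}(P_1^*, T)
    \to \mathrm{Hom}(P_0^*, T)$. In the code balanced forms on $M \times T$ stand for the tensor
    product.

    No Grothendieck group is built either: a class is represented by the function $X \mapsto \dim
    \mathrm{Hom}(P_0, X) - \dim \mathrm{Hom}(P_1, X)$, which Schanuel's lemma makes independent of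
    the resolution, and the counting is done by ranks of rational matrices.

    In the grade 2 case the delicate point is that $T$ is indecomposable: a summand of $P_1$ killed
    by $P_1 \to P_0$ would give $T$ a projective summand that $M$ does not see. Minimality of the
    presentation at $P_1$ excludes this. *)

Section LinearAlgebra.
Variables (K : fieldType).
Implicit Types V W : vectType K.

Lemma linear_inj V W (f : {linear V -> W}) :
  (forall x, f x = 0 -> x = 0) -> injective f.
Proof.
move=> f0 x y /eqP; rewrite -subr_eq0 -linearB => /eqP/f0/eqP.
by rewrite subr_eq0 => /eqP.
Qed.

Lemma linfun_lker0 V W (f : {linear V -> W}) :
  injective f -> lker (linfun f) == 0%VS.
Proof. by move=> f_inj; apply/lker0P => x y; rewrite !lfunE; apply: f_inj. Qed.

Lemma lin_inv_inj V W (f : {linear V -> W}) :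
  injective f -> exists g : {linear W -> V}, cancel f g.
Proof.
move=> /linfun_lker0 kerF; exists ((linfun f)^-1)%VF => x /=.
by have := lker0_lfunK kerF x; rewrite lfunE.
Qed.

Lemma lin_inv_surj V W (f : {linear V -> W}) :
  (forall y, exists x, f x = y) -> exists g : {linear W -> V}, cancel g f.
Proof.
move=> f_surj; exists ((linfun f)^-1)%VF => y; have [x <-] := f_surj y.
have := @limg_lfunVK _ _ _ (linfun f) (linfun f x) (memv_img _ (memvf x)).
by rewrite !lfunE.
Qed.

Lemma inj_endo_surj V (f : {linear V -> V}) :
  injective f -> forall y, exists x, f x = y.
Proof.
move=> /linfun_lker0 kerF y.
have : y \in limg (linfun f).
  suff -> : limg (linfun f) = fullv by exact: memvf.
  apply/eqP; rewrite eqEdim subvf /= limg_dim_eq //.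
  by rewrite (eqP kerF) capv0.
by case/memv_imgP => x _ ->; exists x; rewrite lfunE.
Qed.

Lemma separating_functional V (W : {vspace V}) (v : V) :
  v \notin W -> exists2 l : {linear V -> K^o},
    (forall w, w \in W -> l w = 0) & l v != 0.
Proof.
move=> vW; pose q : 'End(V) := (\1 - projv W)%VF.
have qE w : q w = w - projv W w by rewrite add_lfunE opp_lfunE id_lfunE.
have [i qi] : exists i, coord (vbasis fullv) i (q v) != 0.
  apply/existsP; rewrite -negb_forall; apply: contra vW => /forallP q0.
  suff /eqP : q v = 0 by rewrite qE subr_eq0 => /eqP ->; apply: memv_proj.
  rewrite (coord_vbasis (memvf (q v))) big1 // => i _.
  by rewrite (eqP (q0 i)) scale0r.
exists (coord (vbasis fullv) i \o q) => //= w wW.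
by rewrite qE projv_id // subrr linear0.
Qed.

End LinearAlgebra.

(** * Morphisms of modules *)

Section Morphisms.
Variables (K : fieldType) (A : falgType K).
Implicit Types L M N X Y E : rmod A.

(** Bundled elements of [homv M N]: morphisms can be given by functions, and equations between them
    are stated pointwise. *)
Record mor M N := Mor {
  mor_fun :> M -> N;
  mor_linear : linear mor_fun;
  mor_ract : forall x a, mor_fun (ract x a) = ract (mor_fun x) a
}.

HB.instance Definition _ M N (f : mor M N) :=
  GRing.isLinear.Build K M N *:%R f (mor_linear f).

Section MorLinear.
Variables (M N : rmod A) (f : mor M N).

Lemma mor0 : f 0 = 0. Proof. exact: (linear0 f). Qed.
Lemma morD x y : f (x + y) = f x + f y. Proof. exact: (linearD f). Qed.
Lemma morN x : f (- x) = - f x. Proof. exact: (linearN f). Qed.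
Lemma morB x y : f (x - y) = f x - f y. Proof. exact: (linearB f). Qed.
Lemma morZ k x : f (k *: x) = k *: f x. Proof. exact: (linearZ_LR f). Qed.
Lemma mor_sum I (r : seq I) (P : pred I) (F : I -> M) :
  f (\sum_(i <- r | P i) F i) = \sum_(i <- r | P i) f (F i).
Proof. exact: (linear_sum f). Qed.

End MorLinear.

Lemma ract0 M (a : A) : ract (0 : M) a = 0.
Proof. exact: (linear0 (ractr a : {linear M -> M})). Qed.

Lemma ractD M (x y : M) a : ract (x + y) a = ract x a + ract y a.
Proof. exact: (linearD (ractr a : {linear M -> M})). Qed.

Lemma ractB M (x y : M) a : ract (x - y) a = ract x a - ract y a.
Proof. exact: (linearB (ractr a : {linear M -> M})). Qed.

Lemma ractZ M k (x : M) a : ract (k *: x) a = k *: ract x a.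
Proof. exact: (linearZ_LR (ractr a : {linear M -> M})). Qed.

Lemma ract_sum M I (r : seq I) (P : pred I) (F : I -> M) a :
  ract (\sum_(i <- r | P i) F i) a = \sum_(i <- r | P i) ract (F i) a.
Proof. exact: (linear_sum (ractr a : {linear M -> M})). Qed.

Lemma ractDr M (x : M) a b : ract x (a + b) = ract x a + ract x b.
Proof. exact: (linearD (ractl x)). Qed.

Lemma ractZr M k (x : M) a : ract x (k *: a) = k *: ract x a.
Proof. exact: (linearZ_LR (ractl x)). Qed.

Definition mor_of_hom M N (f : 'Hom(M, N)) (fH : f \in homv M N) : mor M N :=
  Mor (@linearP _ _ _ _ f) (elimT (homvP f) fH).

Lemma hom_of_mor M N (f : mor M N) :
  exists2 g : 'Hom(M, N), g \in homv M N & g =1 f.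
Proof.
exists (linfun f); last by move=> x; rewrite lfunE.
by apply/homvP => x a; rewrite !lfunE /= mor_ract.
Qed.

Definition idm M : mor M M := @Mor M M id (fun _ _ _ => erefl) (fun _ _ => erefl).

Fact compm_linear L M N (g : mor M N) (f : mor L M) : linear (fun x => g (f x)).
Proof. by move=> k x y; rewrite !linearP. Qed.
Fact compm_ract L M N (g : mor M N) (f : mor L M) x a :
  g (f (ract x a)) = ract (g (f x)) a.
Proof. by rewrite !mor_ract. Qed.
Definition compm L M N g f : mor L N := Mor (@compm_linear L M N g f) (compm_ract g f).

Fact zerom_linear M N : linear (fun _ : M => 0 : N).
Proof. by move=> k x y; rewrite scaler0 addr0. Qed.
Fact zerom_ract M N (x : M) (a : A) : 0 = ract (0 : N) a.
Proof. by rewrite ract0. Qed.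
Definition zerom M N : mor M N := Mor (@zerom_linear M N) (@zerom_ract M N).

Fact addm_linear M N (f g : mor M N) : linear (fun x => f x + g x).
Proof. by move=> k x y; rewrite !linearP scalerDr addrACA. Qed.
Fact addm_ract M N (f g : mor M N) x a :
  f (ract x a) + g (ract x a) = ract (f x + g x) a.
Proof. by rewrite !mor_ract ractD. Qed.
Definition addm M N (f g : mor M N) : mor M N :=
  Mor (addm_linear f g) (addm_ract f g).

Fact scalem_linear M N k (f : mor M N) : linear (fun x => k *: f x).
Proof. by move=> c x y; rewrite (linearP f) scalerDr !scalerA mulrC. Qed.
Fact scalem_ract M N k (f : mor M N) x a : k *: f (ract x a) = ract (k *: f x) a.
Proof. by rewrite !mor_ract ractZ. Qed.
Definition scalem M N k (f : mor M N) : mor M N :=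
  Mor (scalem_linear k f) (scalem_ract k f).

Definition subm M N (f g : mor M N) := addm f (scalem (-1) g).

Lemma submE M N (f g : mor M N) x : subm f g x = f x - g x.
Proof. by rewrite /= scaleN1r. Qed.

Fact summ_linear M N n (f : 'I_n -> mor M N) : linear (fun x => \sum_i f i x).
Proof.
move=> k x y; rewrite scaler_sumr -big_split; apply: eq_bigr => i _.
exact: linearP.
Qed.
Fact summ_ract M N n (f : 'I_n -> mor M N) x a :
  \sum_i f i (ract x a) = ract (\sum_i f i x) a.
Proof. by rewrite ract_sum; apply: eq_bigr => i _; rewrite mor_ract. Qed.
Definition summ M N n (f : 'I_n -> mor M N) : mor M N :=
  Mor (summ_linear f) (summ_ract f).

Definition surj M N (f : mor M N) := forall y, exists x, f x = y.

Definition ses L E M (i : mor L E) (p : mor E M) :=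
  [/\ injective i, surj p & forall x, p x = 0 <-> exists y, x = i y].

Lemma ses_comp L E M (i : mor L E) (p : mor E M) : ses i p -> forall y, p (i y) = 0.
Proof. by case=> _ _ ex y; apply/ex; exists y. Qed.

(** A $K$-linear left inverse of [i] is enough: composed with [h] it is $A$-linear because [i] is
    injective. *)
Lemma inj_fact X M N (i : mor M N) (h : mor X N) :
  injective i -> (forall x, exists y, h x = i y) ->
  exists h' : mor X M, forall x, i (h' x) = h x.
Proof.
move=> i_inj h_im; have [j ij] := lin_inv_inj i_inj.
have jK x : i (j (h x)) = h x by have [y ->] := h_im x; rewrite ij.
have lin : linear (fun x => j (h x)) by move=> k x y; rewrite !linearP.
have act x a : j (h (ract x a)) = ract (j (h x)) a.
  by apply: i_inj; rewrite jK !mor_ract jK.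
by exists (Mor lin act).
Qed.

(** Dually, a $K$-linear section of [p] is enough, since [h] does not see the choice of
    preimages. *)
Lemma surj_fact X M N (p : mor M N) (h : mor M X) :
  surj p -> (forall x, p x = 0 -> h x = 0) ->
  exists h' : mor N X, forall x, h' (p x) = h x.
Proof.
move=> p_surj h0; have [s sK] := lin_inv_surj p_surj.
have sE x : h (s (p x)) = h x.
  by apply/eqP; rewrite -subr_eq0 -morB h0 // morB sK subrr.
have lin : linear (fun x => h (s x)) by move=> k x y; rewrite !linearP.
have act x a : h (s (ract x a)) = ract (h (s x)) a.
  by have [y <-] := p_surj x; rewrite -mor_ract !sE mor_ract.
by exists (Mor lin act).
Qed.

Lemma ses_fact X L E M (i : mor L E) (p : mor E M) (h : mor X E) :
  ses i p -> (forall x, p (h x) = 0) ->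
  exists h' : mor X L, forall x, i (h' x) = h x.
Proof. by case=> i_inj _ ex ph0; apply: inj_fact => // x; apply/ex. Qed.

Lemma submodule M (U : {vspace M}) : submod U ->
  exists L (i : mor L M), injective i /\ forall x, x \in U <-> exists y, x = i y.
Proof.
move=> subU; pose act (u : subvs_of U) a := vsproj U (ract (vsval u) a).
have actE u a : vsval (act u a) = ract (vsval u) a.
  by rewrite vsprojK // subU // subvsP.
have vI : injective (@vsval K M U) := val_inj.
have vD k (u v : subvs_of U) : vsval (k *: u + v) = k *: vsval u + vsval v.
  exact: linearP.
have linl a : linear (act^~ a).
  by move=> k x y; apply: vI; rewrite vD !actE vD ractD ractZ.
have linr x : linear (act x).
  by move=> k a b; apply: vI; rewrite vD !actE ractDr ractZr.
have act1 x : act x 1 = x by apply: vI; rewrite actE ract1.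
have actM x a b : act x (a * b) = act (act x a) b.
  by apply: vI; rewrite !actE ractM.
pose L := @RMod K A (subvs_of U) act linl linr act1 actM.
have lin : linear (vsval : L -> M) by move=> k x y; rewrite linearP.
exists L, (Mor lin actE); split; first exact: vI.
move=> x; split=> [xU | [y ->]]; last exact: subvsP.
by exists (vsproj U x); rewrite /= vsprojK.
Qed.

Lemma quotient M (U : {vspace M}) : submod U ->
  exists C (p : mor M C), surj p /\ forall x, p x = 0 <-> x \in U.
Proof.
(* The carrier is a vector space complement of [U]; by [q_act], acting in [M] and projecting back is
   an action on it. *)
move=> subU; pose C := subvs_of (U^C)%VS.
pose q x : C := vsproj (U^C)%VS (x - projv U x).
have qE x : vsval (q x) = x - projv U x by rewrite vsprojK // memv_projC.
have vI : injective (@vsval K M (U^C)%VS) := val_inj.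
have q_lin : linear q.
  move=> k x y; apply: vI; rewrite [RHS]linearP /= !qE linearP.
  by rewrite opprD addrACA -scalerBr.
have q0 x : q x = 0 <-> x \in U.
  split=> [/(congr1 vsval)/eqP | xU]; last first.
    by apply: vI; rewrite qE projv_id // subrr linear0.
  by rewrite qE linear0 subr_eq0 => /eqP ->; apply: memv_proj.
have qK u : q (vsval u) = u.
  apply: vI; rewrite qE.
  have : projv U (vsval u) = 0.
    by apply/eqP; rewrite -memv_ker lker_proj subvsP.
  by move=> ->; rewrite subr0.
pose qL := GRing.isLinear.Build K M C *:%R q q_lin.
pose Q : {linear M -> C} := HB.pack q qL.
have qB x y : q (x - y) = q x - q y := linearB Q x y.
have q_act x y a : q x = q y -> q (ract x a) = q (ract y a).
  move=> /eqP; rewrite -subr_eq0 -qB => /eqP/q0 xyU.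
  by apply/eqP; rewrite -subr_eq0 -qB -ractB; apply/eqP/q0/subU.
pose act (u : C) a := q (ract (vsval u) a).
have actE x a : act (q x) a = q (ract x a) by apply: q_act; rewrite qK.
have linl a : linear (act^~ a).
  by move=> k x y; rewrite /act -q_lin linearP /= ractD ractZ.
have linr x : linear (act x) by move=> k a b; rewrite /act -q_lin ractDr ractZr.
have act1 x : act x 1 = x by rewrite /act ract1 qK.
have actM x a b : act x (a * b) = act (act x a) b.
  by rewrite {1 3}/act actE ractM.
pose D := @RMod K A C act linl linr act1 actM.
exists D, (@Mor M D q q_lin (fun x a => esym (actE x a))); split=> //.
by move=> y; exists (vsval y); apply: qK.
Qed.

End Morphisms.

(** * Kernels, cokernels, retracts and direct sums *)

Section Objects.
Variables (K : fieldType) (A : falgType K).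
Implicit Types L M N X Y E P Q : rmod A.

Lemma kernel E M (p : mor E M) :
  exists L (i : mor L E), injective i /\ forall x, p x = 0 <-> exists y, x = i y.
Proof.
have [g gH gE] := hom_of_mor p.
have kerP x : (x \in lker g) <-> p x = 0.
  by rewrite memv_ker gE; split=> /eqP.
have [|L [i [i_inj iE]]] := @submodule _ _ E (lker g).
  by move=> x a /kerP px0; apply/kerP; rewrite mor_ract px0 ract0.
by exists L, i; split=> // x; rewrite -kerP.
Qed.

Lemma kernel_ses E M (p : mor E M) : surj p -> exists L (i : mor L E), ses i p.
Proof. by move=> ps; have [L [i [ii ex]]] := kernel p; exists L, i; split. Qed.

Lemma image_sub M N (f : mor M N) : exists U : {vspace N},
  submod U /\ forall y, y \in U <-> exists x, y = f x.
Proof.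
have [g gH gE] := hom_of_mor f.
have imP y : (y \in limg g) <-> exists x, y = f x.
  by split=> [/memv_imgP[x _ ->] | [x ->]]; [exists x | rewrite -gE memv_img ?memvf].
exists (limg g); split=> // y a /imP[x ->]; apply/imP.
by exists (ract x a); rewrite mor_ract.
Qed.

Lemma image_fact M N (f : mor M N) : exists I (e : mor M I) (i : mor I N),
  [/\ surj e, injective i & forall x, i (e x) = f x].
Proof.
have [U [subU imU]] := image_sub f; have [I [i [i_inj iE]]] := submodule subU.
have [|e eE] := @inj_fact _ _ M I N i f i_inj.
  by move=> x; apply/iE/imU; exists x.
exists I, e, i; split=> // y.
have /imU[x xE] : i y \in U by apply/iE; exists y.
by exists x; apply: i_inj; rewrite eE.
Qed.

Lemma cokernel M N (f : mor M N) : exists C (p : mor N C),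
  surj p /\ forall y, p y = 0 <-> exists x, y = f x.
Proof.
have [U [subU imU]] := image_sub f; have [C [p [ps pE]]] := quotient subU.
by exists C, p; split=> // y; rewrite pE imU.
Qed.

Definition isom M N := exists (f : mor M N) (g : mor N M),
  cancel f g /\ cancel g f.

Lemma isom_bij M N (f : mor M N) : injective f -> surj f ->
  exists g : mor N M, cancel f g /\ cancel g f.
Proof.
move=> f_inj f_surj.
have [|g gE] := @inj_fact _ _ N M N f (idm N) f_inj.
  by move=> x; have [y <-] := f_surj x; exists y.
by exists g; split=> x; [apply: f_inj; rewrite gE | rewrite gE].
Qed.

Lemma isoP M N : iso M N <-> isom M N.
Proof.
split=> [[f fH [g fK gK]] | [f [g [fK gK]]]].
  have [|y|h [h1 h2]] := @isom_bij M N (mor_of_hom fH); first exact: can_inj fK.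
    by exists (g y); apply: gK.
  by exists (mor_of_hom fH), h.
have [h hH hE] := hom_of_mor f; exists h => //.
by exists g => x; rewrite hE.
Qed.

Lemma isom_refl M : isom M M. Proof. by exists (idm M), (idm M). Qed.
Lemma isom_sym M N : isom M N -> isom N M.
Proof. by case=> f [g [fK gK]]; exists g, f. Qed.
Lemma isom_trans N M L : isom M N -> isom N L -> isom M L.
Proof.
case=> f [g [fK gK]] [f' [g' [fK' gK']]]; exists (compm f' f), (compm g g').
by split=> x /=; rewrite ?fK' ?gK ?fK ?gK'.
Qed.

Definition retract M N := exists (i : mor M N) (p : mor N M), cancel i p.

Lemma isom_retract M N : isom M N -> retract M N.
Proof. by case=> f [g [fK gK]]; exists f, g. Qed.
Lemma retract_trans N M L : retract M N -> retract N L -> retract M L.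
Proof.
case=> f [g fK] [f' [g' fK']]; exists (compm f' f), (compm g g') => x /=.
by rewrite fK'.
Qed.

Definition bip M X Y := exists (i1 : mor X M) (p1 : mor M X) (i2 : mor Y M) (p2 : mor M Y),
  [/\ cancel i1 p1, cancel i2 p2, forall x, p2 (i1 x) = 0, forall y, p1 (i2 y) = 0
    & forall m, m = i1 (p1 m) + i2 (p2 m)].

Section Dsum.
Variables X Y : rmod A.
Definition dinl : mor X (dsum X Y).
Proof.
apply: (@Mor _ _ X (dsum X Y) (fun x => (x, 0))) => [k x y | x a].
  by congr (_, _); rewrite /= ?scaler0 ?addr0.
by congr (_, _); rewrite /= ?ract0.
Defined.
Definition dinr : mor Y (dsum X Y).
Proof.
apply: (@Mor _ _ Y (dsum X Y) (fun y => (0, y))) => [k x y | x a].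
  by congr (_, _); rewrite /= ?scaler0 ?addr0.
by congr (_, _); rewrite /= ?ract0.
Defined.
Definition dfst : mor (dsum X Y) X :=
  @Mor _ _ (dsum X Y) X fst (fun k x y => erefl) (fun x a => erefl).
Definition dsnd : mor (dsum X Y) Y :=
  @Mor _ _ (dsum X Y) Y snd (fun k x y => erefl) (fun x a => erefl).

Lemma dsum_bip : bip (dsum X Y) X Y.
Proof.
exists dinl, dfst, dinr, dsnd; split=> // -[x y].
by rewrite /=; congr (_, _); rewrite ?add0r ?addr0.
Qed.
End Dsum.

Lemma bip_dsum M X Y : bip M X Y <-> isom M (dsum X Y).
Proof.
split=> [[i1 [p1 [i2 [p2 [h1 h2 h3 h4 h5]]]]] | [f [g [fK gK]]]].
  exists (addm (compm (dinl X Y) p1) (compm (dinr X Y) p2)).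
  exists (addm (compm i1 (dfst X Y)) (compm i2 (dsnd X Y))); split=> [x|[x y]] /=.
    by rewrite addr0 add0r -h5.
  by congr (_, _); rewrite !morD !(h1, h2, h3, h4) ?addr0 ?add0r ?addr0.
have [i1 [p1 [i2 [p2 [h1 h2 h3 h4 h5]]]]] := dsum_bip X Y.
exists (compm g i1), (compm p1 f), (compm g i2), (compm p2 f).
split=> [x|x|x|x|m] /=; rewrite ?gK ?h1 ?h2 ?h3 ?h4 //.
by rewrite -morD -h5 fK.
Qed.

Lemma bip_retract M X Y : bip M X Y -> retract X M.
Proof. by case=> i1 [p1 [i2 [p2 [h1 h2 h3 h4 h5]]]]; exists i1, p1. Qed.

Lemma retract_compl X M (i : mor X M) (p : mor M X) : cancel i p ->
  exists Y (j : mor Y M) (q : mor M Y),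
  [/\ cancel j q, forall x, q (i x) = 0, forall y, p (j y) = 0
    & forall m, m = i (p m) + j (q m)].
Proof.
move=> ip; have [Y [j [j_inj jE]]] := kernel p.
have [|q qE] := @inj_fact _ _ M Y M j (subm (idm M) (compm i p)) j_inj.
  by move=> x; apply/jE; rewrite submE morB /= ip subrr.
have pj y : p (j y) = 0 by apply/jE; exists y.
exists Y, j, q; split=> //.
- by move=> y; apply: j_inj; rewrite qE submE /= pj mor0 subr0.
- by move=> x; apply: j_inj; rewrite qE submE /= ip subrr mor0.
by move=> m; rewrite qE submE /= addrC subrK.
Qed.

Lemma summand_retract X M : summand X M <-> retract X M.
Proof.
split=> [[Y /isoP/bip_dsum/bip_retract //] | [i [p ip]]].
have [Y [j [q [h1 h2 h3 h4]]]] := retract_compl ip.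
by exists Y; apply/isoP/bip_dsum; exists i, p, j, q.
Qed.

Lemma zero_mod_zero : is_zero (zero_mod : rmod A).
Proof. by move=> x; apply: zero_mod_eq. Qed.

Lemma indec_split M X (i : mor X M) (p : mor M X) :
  indecomposable M -> ~ is_zero X -> cancel i p -> cancel p i.
Proof.
move=> [M0 Mi] X0 ip; have [Y [j [q [h1 h2 h3 h4]]]] := retract_compl ip.
have /Mi[//|Y0] : iso M (dsum X Y) by apply/isoP/bip_dsum; exists i, p, j, q.
by move=> m; rewrite [RHS]h4 (Y0 (q m)) mor0 addr0.
Qed.

Lemma indec_retract M X : indecomposable M -> ~ is_zero X -> retract X M -> isom X M.
Proof. by move=> Mi X0 [i [p ip]]; exists i, p; split=> //; apply: indec_split ip. Qed.

(** Direct sum data internal to [M], so that [M] need not be literally a [bigdsum]. *)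
Definition isdsum n M (X : 'I_n -> rmod A)
    (i : forall k, mor (X k) M) (p : forall k, mor M (X k)) :=
  [/\ forall k, cancel (i k) (p k), forall k l, k != l -> forall x, p l (i k x) = 0
    & forall m, m = \sum_k i k (p k m)].

Definition bigdsum n (X : 'I_n -> rmod A) : rmod A :=
  \big[@dsum K A/zero_mod]_(k < n) X k.

Lemma bigdsumP n (X : 'I_n -> rmod A) : exists i p, @isdsum n (bigdsum X) X i p.
Proof.
rewrite /bigdsum; elim: n X => [|n IH] X.
  exists (fun k => zerom _ _), (fun k => zerom _ _); split=> [[]|[]|m] //.
  by rewrite [RHS]big_ord0; move: m; rewrite big_ord0; apply: zero_mod_zero.
have [i [p [h1 h2 h3]]] := IH (fun k => X (lift ord0 k)); rewrite big_ord_recl.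
set B := \big[_/_]_(_ < n) _ in i p h1 h2 h3 *.
(* The type [X k] varies with [k], so each component is cast along the equation given by [unliftP];
   [eq_axiomK] removes the casts in the four computation rules. *)
pose i' (k : 'I_n.+1) : mor (X k) (dsum (X ord0) B) :=
  match unliftP ord0 k with
  | UnliftSome l e => ecast k (mor (X k) _) (esym e) (compm (dinr (X ord0) B) (i l))
  | UnliftNone e => ecast k (mor (X k) _) (esym e) (dinl (X ord0) B)
  end.
pose p' (k : 'I_n.+1) : mor (dsum (X ord0) B) (X k) :=
  match unliftP ord0 k with
  | UnliftSome l e => ecast k (mor _ (X k)) (esym e) (compm (p l) (dsnd (X ord0) B))
  | UnliftNone e => ecast k (mor _ (X k)) (esym e) (dfst (X ord0) B)
  end.
have i0 : i' ord0 = dinl (X ord0) B.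
  rewrite /i'; case: unliftP => [l e|e]; first by case: (elimN eqP (neq_lift ord0 l)).
  by rewrite (eq_axiomK e).
have iS l : i' (lift ord0 l) = compm (dinr (X ord0) B) (i l).
  rewrite /i'; case: unliftP => [k e|e]; last by case: (elimN eqP (neq_lift ord0 l)).
  by have kl := lift_inj e; case: k / kl e => e; rewrite (eq_axiomK e).
have p0 : p' ord0 = dfst (X ord0) B.
  rewrite /p'; case: unliftP => [l e|e]; first by case: (elimN eqP (neq_lift ord0 l)).
  by rewrite (eq_axiomK e).
have pS l : p' (lift ord0 l) = compm (p l) (dsnd (X ord0) B).
  rewrite /p'; case: unliftP => [k e|e]; last by case: (elimN eqP (neq_lift ord0 l)).
  by have kl := lift_inj e; case: k / kl e => e; rewrite (eq_axiomK e).
exists i', p'; split.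
- move=> k x; case: (unliftP ord0 k) x => [l|] -> x; rewrite ?iS ?pS ?i0 ?p0 //=.
  exact: h1.
- move=> k l; case: (unliftP ord0 k) => [k'|] ->; case: (unliftP ord0 l) => [l'|] -> //.
  + by rewrite (inj_eq lift_inj) => kl x; rewrite iS pS /= h2.
  + by move=> _ x; rewrite iS p0.
  + by move=> _ x; rewrite i0 pS /= mor0.
case=> x y; rewrite big_ord_recl i0 p0 (eq_bigr (fun k => dinr (X ord0) B (i k (p k y)))).
  by rewrite -mor_sum -h3 /=; congr (_, _); rewrite ?addr0 ?add0r.
by move=> k _; rewrite iS pS.
Qed.

End Objects.

(** * Projective dimension at most one and Ext^1 *)

Section Homological.
Variables (K : fieldType) (A : falgType K).
Implicit Types L M N X Y E P Q : rmod A.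

Definition proj P := forall M N (g : mor M N) (f : mor P N), surj g ->
  exists h : mor P M, forall x, g (h x) = f x.

Lemma projP P : projective P <-> proj P.
Proof.
split=> [Pp M N g f gs | Pp M N g f gH gs fH].
  have [g' gH gE] := hom_of_mor g; have [f' fH fE] := hom_of_mor f.
  have [|h hH hE] := Pp M N g' f' gH _ fH.
    apply/eqP; rewrite eqEsubv subvf /=; apply/subvP=> y _.
    by have [x <-] := gs y; rewrite -gE memv_img ?memvf.
  by exists (mor_of_hom hH) => x /=; rewrite -gE -fE -hE comp_lfunE.
have [|h hE] := Pp M N (mor_of_hom gH) (mor_of_hom fH).
  move=> y; have : y \in limg g by rewrite gs memvf.
  by case/memv_imgP => x _ ->; exists x.
have [h' hH h'E] := hom_of_mor h; exists h' => //.
by apply/lfunP=> x; rewrite comp_lfunE h'E; apply: hE.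
Qed.

Lemma proj_sum n M (X : 'I_n -> rmod A) (i : forall k, mor (X k) M)
    (p : forall k, mor M (X k)) :
  (forall m, m = \sum_k i k (p k m)) -> (forall k, proj (X k)) -> proj M.
Proof.
move=> ip Xp U V g f gs.
have [h hE] := fin_all_exists (fun k => Xp k _ _ g (compm f (i k)) gs).
exists (summ (fun k => compm (h k) (p k))) => x /=.
by rewrite mor_sum [in RHS](ip x) mor_sum; apply: eq_bigr => k _; rewrite hE.
Qed.

Lemma proj_retract P Q : retract P Q -> proj Q -> proj P.
Proof.
case=> i [p ip] Qp M N g f gs; have [h hE] := Qp M N g (compm f p) gs.
by exists (compm h i) => x /=; rewrite hE /= ip.
Qed.

Lemma proj_zero P : is_zero P -> proj P.
Proof.
move=> P0 M N g f gs; exists (zerom P M) => x /=.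
by rewrite (P0 x) !mor0.
Qed.

Lemma proj_bip P X Y : bip P X Y -> proj X -> proj Y -> proj P.
Proof.
case=> i1 [p1 [i2 [p2 [_ _ _ _ h]]]] Xp Yp M N g f gs.
have [h1 h1E] := Xp M N g (compm f i1) gs.
have [h2 h2E] := Yp M N g (compm f i2) gs.
exists (addm (compm h1 p1) (compm h2 p2)) => x /=.
by rewrite morD h1E h2E /= -morD -h.
Qed.

Lemma proj_bigdsum n (X : 'I_n -> rmod A) :
  (forall k, proj (X k)) -> proj (bigdsum X).
Proof. by have [i [p [_ _ h]]] := bigdsumP X; apply: proj_sum h. Qed.

Lemma regular_mor M (m : M) :
  exists f : mor (regular A) M, forall a, f a = ract m a.
Proof.
exists (@Mor _ _ (regular A) M (fun a => ract m a) (ract_linearr m)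
         (fun a b => ractM m a b)) => //.
Qed.

Lemma regular_proj : proj (regular A).
Proof.
move=> M N g f gs; have [m mE] := gs (f 1); have [h hE] := regular_mor m.
exists h => x; rewrite hE mor_ract mE -mor_ract; congr (f _); exact: mul1r.
Qed.

Definition freem n : rmod A := bigdsum (fun _ : 'I_n => regular A).

Lemma freem_proj n : proj (freem n).
Proof. by apply: proj_bigdsum => _; apply: regular_proj. Qed.

Lemma free_cover M : exists n (p : mor (freem n) M), surj p.
Proof.
pose B := vbasis (fullv : {vspace M}).
have [i [q [h1 h2 h3]]] := bigdsumP (fun _ : 'I_(\dim {:M}) => regular A).
have [f fE] := fin_all_exists (fun k : 'I_(\dim {:M}) => regular_mor B`_k).
exists _, (summ (fun k => compm (f k) (q k))) => y.
exists (\sum_k i k (coord B k y *: 1)).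
rewrite /= {2}(coord_vbasis (memvf y)); apply: eq_bigr => k _.
rewrite mor_sum (bigD1 k) //= big1 => [|l lk]; last by rewrite h2.
by rewrite h1 addr0 fE ractZr ract1.
Qed.

(** The functionals are the coordinates of a section of a free cover. *)
Lemma dual_basis P : proj P ->
  exists n (x : 'I_n -> P) (phi : 'I_n -> mor P (regular A)),
    forall y, y = \sum_k ract (x k) (phi k y).
Proof.
move=> Pp; have [n [p ps]] := free_cover P.
have [h hE] := Pp _ _ p (idm P) ps.
have [i [q [h1 h2 h3]]] := bigdsumP (fun _ : 'I_n => regular A).
exists n, (fun k => p (i k 1)), (fun k => compm (q k) h) => y.
rewrite -{1}[y]hE {1}[h y]h3 mor_sum; apply: eq_bigr => k _ /=.
by rewrite -!mor_ract; congr (p (i k _)); rewrite /= mul1r.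
Qed.

(** One step of a resolution. The syzygy [res1] is arbitrary, so every module has such data and
    [pd1] becomes a property of [res1]. *)
Record res M := Res {
  res1 : rmod A;
  res0 : rmod A;
  resd : mor res1 res0;
  resa : mor res0 M;
  res_proj : proj res0;
  res_ses : ses resd resa
}.

Lemma res_exists M : exists r : res M, True.
Proof.
have [n [p ps]] := free_cover M; have [L [i s]] := kernel_ses ps.
by exists (Res (freem_proj (n := n)) s).
Qed.

Definition pd1 M := exists r : res M, proj (res1 r).

Definition extends M N (r : res M) :=
  forall f : mor (res1 r) N, exists g : mor (res0 r) N, forall y, g (resd r y) = f y.

(** Vanishing of Ext^1(M, N), the cokernel of Hom(res0, N) -> Hom(res1, N). Quantifying over all
    resolutions lets each argument choose its own; [ext1_intro] reduces the check to one. *)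
Definition ext1 M N := forall r : res M, extends N r.

Lemma comparison M M' (r : res M) (r' : res M') (f : mor M M') :
  exists (f0 : mor (res0 r) (res0 r')) (f1 : mor (res1 r) (res1 r')),
    (forall x, resa r' (f0 x) = f (resa r x))
    /\ forall y, resd r' (f1 y) = f0 (resd r y).
Proof.
have [_ ps' _] := res_ses r'.
have [f0 f0E] := res_proj (compm f (resa r)) ps'.
have [|f1 f1E] := ses_fact (h := compm f0 (resd r)) (res_ses r').
  by move=> x /=; rewrite f0E /= (ses_comp (res_ses r)) mor0.
by exists f0, f1.
Qed.

(** A decomposition of the identity of [M] through the [X k] lifts to the
    resolutions up to a homotopy [s]; hence properties of the kernels pass from
    the [X k] to every resolution of [M]. *)
Lemma homotopy n M (X : 'I_n -> rmod A) (i : forall k, mor (X k) M)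
    (p : forall k, mor M (X k)) (r : res M) (t : forall k, res (X k)) :
  (forall m, m = \sum_k i k (p k m)) ->
  exists (a : forall k, mor (res1 (t k)) (res1 r))
    (b0 : forall k, mor (res0 r) (res0 (t k)))
    (b : forall k, mor (res1 r) (res1 (t k))) (s : mor (res0 r) (res1 r)),
    (forall k y, resd (t k) (b k y) = b0 k (resd r y))
    /\ forall y, y = \sum_k a k (b k y) - s (resd r y).
Proof.
move=> ip.
have [a0 /fin_all_exists[a aE]] := fin_all_exists (fun k => comparison (t k) r (i k)).
have [b0 /fin_all_exists[b bE]] := fin_all_exists (fun k => comparison r (t k) (p k)).
have [|s sE] := ses_fact (h := subm (summ (fun k => compm (a0 k) (b0 k))) (idm _)) (res_ses r).
  move=> x; rewrite submE morB /= mor_sum [X in _ - X]ip -sumrB.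
  apply: big1 => k _; have [-> _] := aE k; have [-> _] := bE k.
  by rewrite subrr.
exists a, b0, b, s; split=> [k y|y]; first by have [_ ->] := bE k.
have [ri _ _] := res_ses r; apply: ri.
rewrite morB sE submE mor_sum (eq_bigr (fun k => a0 k (b0 k (resd r y)))) /=.
  by rewrite opprB addrC subrK.
by move=> k _; have [_ ->] := aE k; have [_ ->] := bE k.
Qed.

(** A decomposition of the identity is general enough to cover change of resolution, direct summands
    and finite sums at once. *)
Lemma ext1_sum n M N (X : 'I_n -> rmod A) (i : forall k, mor (X k) M)
    (p : forall k, mor M (X k)) :
  (forall m, m = \sum_k i k (p k m)) ->
  (forall k, exists t : res (X k), extends N t) -> ext1 M N.
Proof.
move=> ip /fin_all_exists[t tN] r f.
have [a [b0 [b [s [bE abs]]]]] := homotopy r t ip.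
have [g gE] := fin_all_exists (fun k => tN k (compm f (a k))).
exists (subm (summ (fun k => compm (g k) (b0 k))) (compm f s)) => y.
rewrite submE [in RHS](abs y) morB. rewrite mor_sum /=; congr (_ - _).
by apply: eq_bigr => k _; rewrite -bE gE.
Qed.

Lemma pd1_sum n M (X : 'I_n -> rmod A) (i : forall k, mor (X k) M)
    (p : forall k, mor M (X k)) (r : res M) :
  (forall m, m = \sum_k i k (p k m)) ->
  (forall k, pd1 (X k)) -> proj (res1 r).
Proof.
move=> ip /fin_all_exists[t tP] V W g f gs.
have [a [b0 [b [s [bE abs]]]]] := homotopy r t ip.
have [h hE] := fin_all_exists (fun k => tP k _ _ g (compm f (a k)) gs).
have [h' h'E] := res_proj (r := r) (compm f s) gs.
exists (subm (summ (fun k => compm (h k) (b k))) (compm h' (resd r))) => y.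
rewrite submE [in RHS](abs y) !morB. rewrite mor_sum /= mor_sum h'E; congr (_ - _).
by apply: eq_bigr => k _; rewrite hE.
Qed.

Lemma ext1_intro M N (r : res M) : extends N r -> ext1 M N.
Proof.
move=> rN.
apply: (ext1_sum (X := fun _ : 'I_1 => M) (i := fun _ => idm M)
  (p := fun _ => idm M)) => [m|_].
  by rewrite big_ord1.
by exists r.
Qed.

Lemma pd1_res M (r : res M) : pd1 M -> proj (res1 r).
Proof.
move=> M1.
apply: (pd1_sum (X := fun _ : 'I_1 => M) (i := fun _ => idm M)
  (p := fun _ => idm M)) => // m.
by rewrite big_ord1.
Qed.

Lemma pd1_retract M M' : retract M M' -> pd1 M' -> pd1 M.
Proof.
move=> [i [p ip]] M1; have [r _] := res_exists M; exists r.
by apply: (pd1_sum (X := fun _ : 'I_1 => M') (i := fun _ => p) (p := fun _ => i)) => // m;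
  rewrite big_ord1 ip.
Qed.

Lemma ext1_proj P N : proj P -> ext1 P N.
Proof.
move=> Pp r f; have [_ ras _] := res_ses r; have [s sE] := Pp _ _ (resa r) (idm P) ras.
have [|q qE] := ses_fact (h := subm (idm (res0 r)) (compm s (resa r))) (res_ses r).
  by move=> x; rewrite submE morB /= sE /= subrr.
exists (compm f q) => y /=; congr (f _); have [di _ _] := res_ses r; apply: di.
by rewrite qE submE /= (ses_comp (res_ses r)) mor0 subr0.
Qed.

Lemma ext1_retractl M M' N : retract M M' -> ext1 M' N -> ext1 M N.
Proof.
move=> [i [p ip]] MN.
apply: (ext1_sum (X := fun _ : 'I_1 => M') (i := fun _ => p) (p := fun _ => i)) => [m|_].
  by rewrite big_ord1 ip.
by have [r _] := res_exists M'; exists r; apply: MN.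
Qed.

Lemma ext1_retractr M N N' : retract N N' -> ext1 M N' -> ext1 M N.
Proof.
move=> [i [p ip]] MN r f; have [g gE] := MN r (compm i f).
by exists (compm p g) => y; rewrite /= gE /= ip.
Qed.

Lemma pd1_bigdsum n (X : 'I_n -> rmod A) : (forall k, pd1 (X k)) -> pd1 (bigdsum X).
Proof.
have [i [p [_ _ ip]]] := bigdsumP X => X1.
by have [r _] := res_exists (bigdsum X); exists r; apply: pd1_sum ip X1.
Qed.

Lemma ext1_bigdsuml n (X : 'I_n -> rmod A) N :
  (forall k, ext1 (X k) N) -> ext1 (bigdsum X) N.
Proof.
have [i [p [_ _ ip]]] := bigdsumP X => XN; apply: (ext1_sum ip) => k.
by have [r _] := res_exists (X k); exists r; apply: XN.
Qed.

Lemma ext1_sumr n M N (X : 'I_n -> rmod A) (i : forall k, mor (X k) N)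
    (p : forall k, mor N (X k)) :
  (forall m, m = \sum_k i k (p k m)) -> (forall k, ext1 M (X k)) -> ext1 M N.
Proof.
move=> ip MX r f.
have [g gE] := fin_all_exists (fun k => MX k r (compm (p k) f)).
exists (summ (fun k => compm (i k) (g k))) => y.
by rewrite /= [in RHS](ip (f y)); apply: eq_bigr => k _; rewrite gE.
Qed.

Lemma ext1_bigdsumr n (X : 'I_n -> rmod A) M :
  (forall k, ext1 M (X k)) -> ext1 M (bigdsum X).
Proof. by have [i [p [_ _ ip]]] := bigdsumP X; apply: ext1_sumr ip. Qed.

(** Projective dimension at most one makes Ext^1(M, -) right exact: maps from the projective syzygy
    to [X] lift to [N]. *)
Lemma ext1_quotient M N X (g : mor N X) : pd1 M -> ext1 M N -> surj g -> ext1 M X.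
Proof.
move=> M1 MN gs r f; have [h hE] := pd1_res (r := r) M1 f gs.
have [h' h'E] := MN r h; exists (compm g h') => y.
by rewrite /= h'E hE.
Qed.

Lemma ext1_middle M X Y Z (i : mor X Y) (p : mor Y Z) :
  ses i p -> ext1 M X -> ext1 M Z -> ext1 M Y.
Proof.
move=> s MX MZ r f; have [ii ps _] := s.
have [h hE] := MZ r (compm p f); have [h' h'E] := res_proj h ps.
have [|q qE] := ses_fact (h := subm f (compm h' (resd r))) s.
  by move=> x; rewrite submE morB /= h'E hE subrr.
have [t tE] := MX r q; exists (addm (compm i t) h') => y.
by rewrite /= tE qE submE /= subrK.
Qed.

(** The piece Hom(M, Y) -> Hom(M, Z) -> Ext^1(M, X) of the long exact sequence: a lift over [res0]
    is corrected until it kills the syzygy. *)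
Lemma ext1_lift M X Y Z (i : mor X Y) (p : mor Y Z) (f : mor M Z) :
  ses i p -> ext1 M X -> exists g : mor M Y, forall m, p (g m) = f m.
Proof.
move=> s MX; have [ii ps _] := s; have [r _] := res_exists M.
have [h hE] := res_proj (compm f (resa r)) ps.
have ri := ses_comp (res_ses r); have [_ ras rex] := res_ses r.
have [|q qE] := ses_fact (h := compm h (resd r)) s.
  by move=> y; rewrite /= hE /= ri mor0.
have [t tE] := MX r q.
have [|g gE] := @surj_fact _ _ Y _ _ (resa r) (subm h (compm i t)) ras.
  by move=> x /rex[y ->]; rewrite submE /= tE qE subrr.
exists g => m; have [x <-] := ras m.
by rewrite gE submE morB hE /= (ses_comp s) subr0.
Qed.

End Homological.

(** * Krull-Schmidt *)

Section KrullSchmidt.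
Variables (K : fieldType) (A : falgType K).
Implicit Types L M N X Y E P Q : rmod A.

Lemma endo_bij M (f : mor M M) : injective f -> exists g : mor M M, cancel f g /\ cancel g f.
Proof. by move=> fi; apply: isom_bij => //; apply: inj_endo_surj. Qed.

Lemma surj_endo_inj M (f : mor M M) : surj f -> injective f.
Proof.
move=> fs; have [s sK] := lin_inv_surj fs.
have ss := inj_endo_surj (can_inj sK).
by move=> x y; have [x' <-] := ss x; have [y' <-] := ss y; rewrite !sK => ->.
Qed.

Definition iterm M (f : mor M M) n : mor M M := iter n (compm f) (idm M).

Lemma itermE M (f : mor M M) n x : iterm f n x = iter n f x.
Proof. by elim: n => //= n ->. Qed.

Lemma image_stable M (f : mor M M) :
  exists n, forall x, exists y, iter n f x = iter n.+1 f y.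
Proof.
pose U n := limg (linfun (iterm f n)).
have UP n y : reflect (exists x, y = iter n f x) (y \in U n).
  apply: (iffP memv_imgP) => [[x _ ->] | [x ->]].
    by exists x; rewrite lfunE /= itermE.
  by exists x; rewrite ?memvf // lfunE /= itermE.
have US n : (U n.+1 <= U n)%VS.
  by apply/subvP => y /UP[x ->]; apply/UP; exists (f x); rewrite iterSr.
have [d] := ubnP (\dim (U 0%N)); elim: d 0%N => // d IH n; rewrite ltnS => dn.
have [e|ne] := eqVneq (U n.+1) (U n).
  by exists n => x; apply/UP; rewrite e; apply/UP; exists x.
apply: (IH n.+1); apply: leq_trans dn; rewrite ltn_neqAle dimvS // andbT.
by apply: contra ne => /eqP e; rewrite eqEdim US e leqnn.
Qed.

Lemma fitting M (f : mor M M) : indecomposable M ->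
  injective f \/ exists n, forall x, iter n f x = 0.
Proof.
move=> Mi; have [n nE] := image_stable f.
have stab k x : exists y, iter n f x = iter (k + n) f y.
  elim: k => [|k [y ->]]; first by exists x.
  by have [z zE] := nE y; exists z; rewrite iterD zE -iterD addnS addSn.
(* The exponent is positive so that [f x = 0] forces [g x = 0]. By [gg], [g] maps its image onto
   itself, so the image is a retract of [M]. *)
pose g := iterm f n.+1.
have gg x : exists y, g x = g (g y).
  have [y yE] := stab n.+2 (f x); exists y.
  by rewrite !itermE iterSr yE -iterD; congr (iter _ f y); rewrite !addSn addnS.
have [I [e [i [es ii ieE]]]] := image_fact g.
have ts : surj (compm e i).
  move=> z; have [x <-] := es z; have [y yE] := gg x.
  by exists (e y); apply: ii; rewrite /= !ieE -yE.
have [t [tK Kt]] := isom_bij (surj_endo_inj ts) ts.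
have [I0|I0] := classic (is_zero I).
  by right; exists n.+1 => x; rewrite -itermE -/(g x) -ieE (I0 (e x)) mor0.
have pi : cancel i (compm t e) by exact: tK.
have ip := indec_split Mi I0 pi.
left; apply: linear_inj => x /= fx0; rewrite -[x]ip /=.
suff -> : e x = 0 by rewrite !mor0.
by apply: ii; rewrite ieE mor0 itermE iterSr fx0 -itermE mor0.
Qed.

(** Locality of the endomorphism ring: a zero of [g] is a fixed point of [v \o f], where [v] inverts
    [u], so [g] is injective once [v \o f] is nilpotent. *)
Lemma indec_local2 M (f g u : mor M M) : indecomposable M -> injective u ->
  (forall x, u x = f x + g x) -> injective f \/ injective g.
Proof.
move=> Mi ui uE; have [v [uK Ku]] := endo_bij ui.
have [vfi | [n vfn]] := fitting (compm v f) Mi.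
  by left=> x y xy; apply: vfi; rewrite /= xy.
right; apply: linear_inj => x /= gx0.
have xE : x = compm v f x by rewrite /= -[x in LHS]uK uE gx0 addr0.
by rewrite -(vfn x); elim: (n) => //= m <-.
Qed.

Lemma indec_local n M (f : 'I_n -> mor M M) : indecomposable M ->
  injective (summ f) -> exists k, injective (f k).
Proof.
move=> Mi; elim: n f => [|n IH] f fi.
  by case: Mi => M0 _; case: M0 => x; apply: fi; rewrite /= !big_ord0.
have [|h|/IH[k kE]] := @indec_local2 M (f ord0) (summ (fun k => f (lift ord0 k))) _ Mi fi.
- by move=> x; rewrite /= big_ord_recl.
- by exists ord0.
by exists (lift ord0 k).
Qed.

(** The identity of [N] is a sum of endomorphisms through the [X k]; by locality one of them is
    invertible. *)
Lemma indec_retract_sum n M (X : 'I_n -> rmod A) (i : forall k, mor (X k) M)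
    (p : forall k, mor M (X k)) N :
  (forall m, m = \sum_k i k (p k m)) -> indecomposable N -> retract N M ->
  exists k, retract N (X k).
Proof.
move=> ip Ni [j [q jq]].
have [|k kE] := @indec_local n N (fun k => compm q (compm (i k) (compm (p k) j))) Ni.
  have qE x : summ (fun k => compm q (compm (i k) (compm (p k) j))) x = x.
    by rewrite /= -mor_sum -ip jq.
  by move=> x y; rewrite !qE.
have [v [vK Kv]] := endo_bij kE.
by exists k, (compm (p k) j), (compm v (compm q (i k))) => x; apply: vK.
Qed.

Lemma isom_dim M N : isom M N -> \dim {:M} = \dim {:N}.
Proof.
case=> f [g [fK gK]].
have kerf := linfun_lker0 (can_inj fK).
rewrite -(@limg_dim_eq _ _ _ (linfun f) fullv) ?(eqP kerf) ?capv0 //.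
congr (\dim _).
apply/eqP; rewrite eqEsubv subvf /=; apply/subvP => y _.
by rewrite -(gK y) -[f _](lfunE f) memv_img ?memvf.
Qed.

Lemma dim_gt0 M : ~ is_zero M -> (0 < \dim {:M})%N.
Proof.
move=> M0; rewrite lt0n; apply/negP => /eqP d0; apply: M0 => x.
have : x \in fullv by apply: memvf.
have /eqP -> : (fullv : {vspace M}) == 0%VS by rewrite -dimv_eq0 d0.
by rewrite memv0 => /eqP.
Qed.

Lemma decomposition M : exists n (X : 'I_n -> rmod A) i p,
  @isdsum _ _ n M X i p /\ forall k, indecomposable (X k).
Proof.
have [d] := ubnP (\dim {:M}); elim: d M => // d IH M; rewrite ltnS => dM.
have [M0|M0] := classic (is_zero M).
  exists 0%N, (fun _ => M), (fun _ => idm M), (fun _ => idm M).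
  by split=> [|[]//]; split=> [[]|[]|m] //; rewrite big_ord0 (M0 m).
have [Mi|Mi] := classic (indecomposable M).
  exists 1%N, (fun _ => M), (fun _ => idm M), (fun _ => idm M).
  split=> //; split=> // [k l|m]; first by rewrite !ord1.
  by rewrite big_ord1.
have [X [Y [MXY X0 Y0]]] : exists X Y, [/\ bip M X Y, ~ is_zero X & ~ is_zero Y].
  apply: NNPP => no; apply: Mi; split=> // X Y /isoP/bip_dsum MXY.
  have [|X0] := classic (is_zero X); first by left.
  have [|Y0] := classic (is_zero Y); first by right.
  by case: no; exists X, Y.
have dXY : \dim {:M} = (\dim {:X} + \dim {:Y})%N.
  by rewrite (isom_dim (iffLR (bip_dsum _ _ _) MXY)) !dimvf.
have [|n [U [i [p [[a1 a2 a3] Ui]]]]] := IH X.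
  by apply: leq_trans dM; rewrite dXY -[X in (X < _)%N]addn0 ltn_add2l dim_gt0.
have [|m [V [j [q [[b1 b2 b3] Vi]]]]] := IH Y.
  by apply: leq_trans dM; rewrite dXY -[X in (X < _)%N]add0n ltn_add2r dim_gt0.
have [iX [pX [iY [pY [c1 c2 c3 c4 c5]]]]] := MXY.
pose W (k : 'I_n + 'I_m) := match k with inl l => U l | inr l => V l end.
pose iW k : mor (W k) M :=
  match k with inl l => compm iX (i l) | inr l => compm iY (j l) end.
pose pW k : mor M (W k) :=
  match k with inl l => compm (p l) pX | inr l => compm (q l) pY end.
exists (n + m)%N, (fun k => W (split k)), (fun k => iW (split k)), (fun k => pW (split k)).
split; last by move=> k; case: (split k) => l; [apply: Ui | apply: Vi].
split.
- by move=> k; case: (split k) => l x /=; rewrite ?c1 ?c2 ?a1 ?b1.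
- move=> k l kl x.
  have : split k != split l by apply: contra kl => /eqP/(can_inj (@splitK _ _))/eqP.
  move: x; case: (split k) => k' x; case: (split l) => l' /= kl';
    rewrite ?c1 ?c2 ?c3 ?c4 ?mor0 ?a2 ?b2 //.
move=> x; rewrite big_split_ord [LHS]c5; congr (_ + _).
  rewrite {1}[pX x]a3 mor_sum; apply: eq_bigr => k _.
  by rewrite -[lshift _ _]/(unsplit (inl k)) unsplitK.
rewrite {1}[pY x]b3 mor_sum; apply: eq_bigr => k _.
by rewrite -[rshift _ _]/(unsplit (inr k)) unsplitK.
Qed.

Lemma isom_representatives n (X : 'I_n -> rmod A) :
  exists m (s : 'I_m -> 'I_n),
    (forall k l, isom (X (s k)) (X (s l)) -> k = l)
    /\ forall j, exists k, isom (X j) (X (s k)).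
Proof.
elim: n X => [|n IH] X; first by exists 0%N, id; split=> [[]|[]].
have [m [s [s1 s2]]] := IH (fun k => X (lift ord0 k)).
have [[k0 X0]|X0] := classic (exists k, isom (X ord0) (X (lift ord0 (s k)))).
  exists m, (fun k => lift ord0 (s k)); split=> // j.
  by case: (unliftP ord0 j) => [l|] ->; [apply: s2 | exists k0].
pose t (k : 'I_m.+1) := if unlift ord0 k is Some l then lift ord0 (s l) else ord0.
have t0 : t ord0 = ord0 by rewrite /t unlift_none.
have tS l : t (lift ord0 l) = lift ord0 (s l) by rewrite /t liftK.
exists m.+1, t; split=> [k l|j].
  case: (unliftP ord0 k) => [k'|] ->; case: (unliftP ord0 l) => [l'|] ->;
    rewrite ?tS ?t0 // => kl.
  - by congr (lift _ _); apply: s1.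
  - by case: X0; exists k'; apply: isom_sym.
  - by case: X0; exists l'.
case: (unliftP ord0 j) => [l|] ->; last by exists ord0; rewrite t0; apply: isom_refl.
by have [k kE] := s2 l; exists (lift ord0 k); rewrite tS.
Qed.

End KrullSchmidt.

(** * Dimensions of Hom spaces *)

Section Dimensions.
Variables (K : fieldType) (A : falgType K).
Implicit Types L M N X Y Z E P Q : rmod A.

Definition hdim M N := \dim (homv M N).

Lemma homv_mor M N (f : mor M N) : linfun f \in homv M N.
Proof. by apply/homvP => x a; rewrite !lfunE /= mor_ract. Qed.

Section Precomposition.
Variables (L M N : rmod A) (p : mor L M).

Definition precomp_fun (f : 'Hom(M, N)) : 'Hom(L, N) := (f \o linfun p)%VF.

Fact precomp_linear : linear precomp_fun.
Proof. by move=> k f g; rewrite /precomp_fun comp_lfunDl comp_lfunZl. Qed.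
HB.instance Definition _ :=
  GRing.isLinear.Build K 'Hom(M, N) 'Hom(L, N) *:%R precomp_fun precomp_linear.

Definition precomp : 'Hom('Hom(M, N), 'Hom(L, N)) := linfun precomp_fun.

Lemma precompE f x : precomp f x = f (p x).
Proof. by rewrite lfunE /= /precomp_fun comp_lfunE lfunE. Qed.

Lemma precomp_img (g : 'Hom(L, N)) :
  reflect (exists2 f : mor M N, True & forall x, g x = f (p x)) (g \in precomp @: homv M N)%VS.
Proof.
apply: (iffP memv_imgP) => [[f fH ->] | [f _ gE]].
  by exists (mor_of_hom fH) => // x; rewrite precompE.
exists (linfun f); first exact: homv_mor.
by apply/lfunP => x; rewrite precompE lfunE gE.
Qed.

Lemma precomp_sub : (precomp @: homv M N <= homv L N)%VS.
Proof.
apply/subvP => g /precomp_img[f _ gE]; apply/homvP => x a.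
by rewrite !gE !mor_ract.
Qed.

End Precomposition.
Arguments precomp {L M} N p.

Lemma hdim_isdsum n M (X : 'I_n -> rmod A) i p Z :
  @isdsum _ _ n M X i p -> hdim M Z = (\sum_k hdim (X k) Z)%N.
Proof.
(* Hom(M, Z) is the direct sum of the subspaces of maps factoring through the projections [p k]. *)
case=> h1 h2 h3; pose U k := (precomp Z (p k) @: homv (X k) Z)%VS.
have dimU k : \dim (U k) = hdim (X k) Z.
  apply: limg_dim_eq; apply/eqP; rewrite -subv0; apply/subvP => f.
  rewrite memv_cap memv_ker memv0 => /andP[_ /eqP f0]; apply/eqP/lfunP => x.
  by rewrite zero_lfunE -[x]h1 -precompE f0 zero_lfunE.
have dxU : directv (\sum_k U k).
  apply/directv_sum_independent => f fU f0 k _.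
  have fE l x : f l x = f l (i l (p l x)).
    by have /precomp_img[g _ gE] := fU l isT; rewrite !gE h1.
  apply/lfunP => x; rewrite zero_lfunE fE.
  have := congr1 (fun g : 'Hom(M, Z) => g (i k (p k x))) f0.
  rewrite zero_lfunE sum_lfunE (bigD1 k) //= big1 ?addr0 // => l lk.
  have /precomp_img[g _ ->] := fU l isT.
  by rewrite h2 ?mor0 // eq_sym.
rewrite /hdim -(eq_bigr _ (fun k _ => dimU k)) -(directvP dxU) /=; congr (\dim _).
apply/eqP; rewrite eqEsubv; apply/andP; split; last first.
  by apply/subv_sumP => k _; apply: precomp_sub.
apply/subvP => f fH.
have -> : f = \sum_k precomp Z (p k) (f \o linfun (i k))%VF.
  apply/lfunP => x; rewrite sum_lfunE [x in LHS]h3 linear_sum; apply: eq_bigr => k _.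
  by rewrite precompE comp_lfunE lfunE.
apply: memv_sumr => k _; apply/precomp_img; exists (compm (mor_of_hom fH) (i k)) => // x.
by rewrite precompE comp_lfunE lfunE.
Qed.

Lemma bip_isdsum M X Y : bip M X Y -> exists i p,
  @isdsum _ _ (1 + 1) M (fun k => if split k is inl _ then X else Y) i p.
Proof.
case=> i1 [p1 [i2 [p2 [h1 h2 h3 h4 h5]]]].
pose W (k : 'I_1 + 'I_1) := if k is inl _ then X else Y.
pose i k : mor (W k) M := match k with inl l => i1 | inr l => i2 end.
pose p k : mor M (W k) := match k with inl l => p1 | inr l => p2 end.
exists (fun k => i (split k)), (fun k => p (split k)); split.
- by move=> k; case: (split k).
- move=> k l kl x.
  have : split k != split l by apply: contra kl => /eqP/(can_inj (@splitK _ _))/eqP.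
  by move: x; case: (split k) => k' x; case: (split l) => l'; rewrite !ord1 ?eqxx //=.
move=> x; rewrite big_split_ord !big_ord1.
rewrite -[lshift _ _]/(unsplit (inl ord0)) -[rshift _ _]/(unsplit (inr ord0)).
by rewrite !unsplitK.
Qed.

Lemma hdim_bip M X Y Z : bip M X Y -> hdim M Z = (hdim X Z + hdim Y Z)%N.
Proof.
case/bip_isdsum => i [p /hdim_isdsum ->]; rewrite big_split_ord !big_ord1.
rewrite -[lshift _ _]/(unsplit (inl ord0)) -[rshift _ _]/(unsplit (inr ord0)).
by rewrite !unsplitK.
Qed.

Lemma hdim_isom M N Z : isom M N -> hdim M Z = hdim N Z.
Proof.
case=> f [g [fK gK]].
rewrite (@hdim_isdsum 1 M (fun _ => N) (fun _ => g) (fun _ => f)) ?big_ord1 //.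
by split=> [//|k l|m]; [rewrite !ord1 | rewrite big_ord1 fK].
Qed.

(** The map [th] from the sum of [res0 r'] and [res1 r] onto [res0 r] splits, and its kernel is
    [res1 r']. This makes [hdim (res0 r) Z - hdim (res1 r) Z] an invariant of [M]. *)
Lemma schanuel M Z (r r' : res M) :
  (hdim (res0 r) Z + hdim (res1 r') Z = hdim (res0 r') Z + hdim (res1 r) Z)%N.
Proof.
have [k [k1 [kE k1E]]] := comparison r' r (idm M).
have [di da dex] := res_ses r; have [di' da' dex'] := res_ses r'.
pose S := dsum (res0 r') (res1 r).
pose th : mor S (res0 r) :=
  addm (compm k (dfst _ _)) (compm (resd r) (dsnd _ _)).
have ths : surj th.
  move=> x; have [u uE] := da' (resa r x).
  have /dex[v vE] : resa r (x - k u) = 0 by rewrite morB kE uE subrr.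
  by exists (u, v); rewrite /= -vE addrC subrK.
have [s sE] := res_proj (idm (res0 r)) ths.
have [Y [j [q [h1 h2 h3 h4]]]] := retract_compl (i := s) (p := th) sE.
have SB : bip S (res0 r) Y by exists s, th, j, q.
have w_lin : linear (fun y : res1 r' => (resd r' y, - k1 y) : S).
  by move=> c x y; congr (_, _); rewrite /= linearP // opprD scalerN.
have w_act y a : ((resd r' (ract y a), - k1 (ract y a)) : S) =
    ract ((resd r' y, - k1 y) : S) a.
  by congr (_, _); rewrite ?mor_ract //= -!scaleN1r ractZ.
(* The sign puts [w] into the kernel of [th]; it fills that kernel, so [q \o w] identifies [res1 r']
   with [Y]. *)
pose w : mor (res1 r') S := Mor w_lin w_act.
have thw y : th (w y) = 0 by rewrite /= morN k1E subrr.
have jqw y : j (q (w y)) = w y by rewrite [RHS]h4 thw mor0 add0r.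
have [|z|g [g1 g2]] := @isom_bij _ _ _ _ (compm q w).
- apply: linear_inj => y /= qw0; have := jqw y; rewrite /= qw0 mor0.
  by case=> d0 _; apply: di'; rewrite mor0 -d0.
- case E : (j z) => [u v]; have := h3 z; rewrite E /= => uv0.
  have /dex'[y uE] : resa r' u = 0.
    have := congr1 (resa r) uv0; rewrite morD kE (ses_comp (res_ses r)) addr0 mor0.
    by [].
  have vE : v = - k1 y.
    by apply: di; rewrite morN k1E -uE; apply/eqP; rewrite -addr_eq0 addrC uv0.
  by exists y; rewrite /= -[RHS]h1 E uE vE.
have YI : isom (res1 r') Y by exists (compm q w), g.
by rewrite (hdim_isom _ YI) -(hdim_bip _ SB) -(hdim_bip _ (dsum_bip _ _)).
Qed.

(** [W] is any set of morphisms: a family in [W] is enlarged while it fails to span [W], and [d]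
    bounds the codimension of its span. *)
Lemma mor_span M N (W : mor M N -> Prop) :
  exists n (f : 'I_n -> mor M N), (forall i, W (f i)) /\
    forall g, W g -> exists c : 'I_n -> K, forall x, g x = \sum_i c i *: f i x.
Proof.
pose V n (f : 'I_n -> mor M N) := (\sum_i <[linfun (f i)]>)%VS.
suff main d n (f : 'I_n -> mor M N) : (forall i, W (f i)) ->
    (\dim {:'Hom(M, N)} - \dim (V n f) < d)%N ->
    exists n (f : 'I_n -> mor M N), (forall i, W (f i)) /\
      forall g, W g -> exists c : 'I_n -> K, forall x, g x = \sum_i c i *: f i x.
  by apply: (main _ 0%N (fun _ => zerom M N) _ (ltnSn _)) => -[].
elim: d n f => // d IH n f fW df.
have [[g [gW gV]]|all] := classic (exists g, W g /\ linfun g \notin V n f).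
  pose f' (k : 'I_n.+1) := if unlift ord0 k is Some l then f l else g.
  apply: (IH n.+1 f') => [k|].
    by rewrite /f'; case: (unlift ord0 k).
  have VE : V n.+1 f' = (<[linfun g]> + V n f)%VS.
    rewrite /V big_ord_recl /f' unlift_none; congr (_ + _)%VS.
    by apply: eq_bigr => k _; rewrite liftK.
  have lt : (\dim (V n f) < \dim (V n.+1 f'))%N.
    rewrite ltn_neqAle dimvS ?VE ?addvSr // andbT; apply: contra gV => /eqP e.
    have /eqP -> : V n f == (<[linfun g]> + V n f)%VS by rewrite eqEdim addvSr e leqnn.
    by rewrite (subvP (addvSl _ _)) ?memv_line.
  rewrite ltnS in df.
  exact: leq_trans (ltn_sub2l (leq_trans lt (dimvS (subvf _))) lt) df.
exists n, f; split=> // g gW.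
have /memv_sumP[h hE gE] : linfun g \in V n f by apply: contraT => gV; case: all; exists g.
have [c cE] := fin_all_exists (fun i => (elimT (@vlineP _ _ _ _) (hE i isT))).
exists c => x; rewrite -[g x](lfunE g) gE sum_lfunE; apply: eq_bigr => i _.
by rewrite cE scale_lfunE lfunE.
Qed.

(** A map from a power of [T] through which all of [W] factors. The second half records that its
    components are themselves in [W], which is needed when [W] consists of radical maps. *)
Lemma approximation T X (W : mor T X -> Prop) :
  exists n (u : mor (bigdsum (fun _ : 'I_n => T)) X),
    (forall f, W f -> exists h : mor T (bigdsum (fun _ : 'I_n => T)),
      forall x, u (h x) = f x) /\
    exists (f : 'I_n -> mor T X) (p : 'I_n -> mor (bigdsum (fun _ : 'I_n => T)) T),
      (forall i, W (f i)) /\ forall y, u y = \sum_i f i (p i y).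
Proof.
have [n [f [fW fspan]]] := mor_span W.
have [i [p [h1 h2 h3]]] := bigdsumP (fun _ : 'I_n => T).
exists n, (summ (fun k => compm (f k) (p k))); split; last by exists f, p.
move=> g /fspan[c cE]; exists (summ (fun k => scalem (c k) (i k))) => x.
rewrite cE /=; apply: eq_bigr => k _; rewrite mor_sum (bigD1 k) //= big1 => [|l lk].
  by rewrite morZ h1 addr0 morZ.
by rewrite morZ h2 // scaler0.
Qed.

End Dimensions.

(** * Test modules and the Euler form *)

Section TestModules.
Variables (K : fieldType) (A : falgType K).
Implicit Types L M N X Y Z E P Q T : rmod A.

Section ResolutionDimensions.
Variables (M X : rmod A) (r : res M).
Let c := precomp X (resd r).

Lemma precomp_ker : (homv (res0 r) X :&: lker c = 0)%VS <->
  forall f : mor M X, forall x, f x = 0.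
Proof.
have [_ ps ex] := res_ses r; split=> [c0 f x | f0].
  have [y <-] := ps x.
  have : linfun (compm f (resa r)) \in (homv (res0 r) X :&: lker c)%VS.
    rewrite memv_cap homv_mor memv_ker; apply/eqP/lfunP => z.
    by rewrite precompE lfunE /= (ses_comp (res_ses r)) mor0 zero_lfunE.
  rewrite c0 memv0 => /eqP/lfunP/(_ y).
  by rewrite lfunE zero_lfunE.
apply/eqP; rewrite -subv0; apply/subvP => g.
rewrite memv_cap memv_ker memv0 => /andP[gH /eqP cg].
have [|f fE] := @surj_fact _ _ X _ _ (resa r) (mor_of_hom gH) ps.
  by move=> x /ex[y ->]; rewrite /= -precompE -/c cg zero_lfunE.
apply/eqP/lfunP => x; rewrite zero_lfunE.
by rewrite -[g x]/(mor_of_hom gH x) -fE f0.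
Qed.

Lemma precomp_full : (c @: homv (res0 r) X = homv (res1 r) X)%VS <-> extends X r.
Proof.
split=> [cE f | rX].
  have := homv_mor f; rewrite -cE => /precomp_img[g _ gE].
  by exists g => y; rewrite -gE lfunE.
apply/eqP; rewrite eqEsubv precomp_sub /=; apply/subvP => f fH.
have [g gE] := rX (mor_of_hom fH).
by apply/precomp_img; exists g => // x; rewrite gE.
Qed.

(** Kernel and cokernel of [c] are Hom(M, X) and Ext^1(M, X), so the difference of the two
    dimensions is the Euler form. This lemma and the next two read off its sign when at least one of
    these spaces vanishes. *)
Lemma hdim_res_eq : ext1 M X -> (forall (f : mor M X) x, f x = 0) ->
  hdim (res0 r) X = hdim (res1 r) X.
Proof.
move=> MX /precomp_ker c0; rewrite /hdim -(iffRL precomp_full (MX r)).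
by rewrite limg_dim_eq.
Qed.

Lemma hdim_res_gt : ext1 M X -> ~ (forall (f : mor M X) x, f x = 0) ->
  (hdim (res1 r) X < hdim (res0 r) X)%N.
Proof.
move=> MX nz; rewrite /hdim -(iffRL precomp_full (MX r)).
rewrite -(limg_ker_dim c (homv (res0 r) X)) -[X in (X < _)%N]add0n ltn_add2r.
by rewrite lt0n dimv_eq0; apply/eqP => /precomp_ker.
Qed.

Lemma hdim_res_lt : ~ ext1 M X -> (forall (f : mor M X) x, f x = 0) ->
  (hdim (res0 r) X < hdim (res1 r) X)%N.
Proof.
move=> MX /precomp_ker c0; rewrite /hdim -(limg_dim_eq c0).
rewrite (ltn_leqif (dimv_leqif_sup (precomp_sub _ _))); apply/negP => sub.
apply: MX; apply: (ext1_intro (r := r)); apply/precomp_full.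
by apply/eqP; rewrite eqEsubv precomp_sub.
Qed.

End ResolutionDimensions.

Section TestModule.
Variables (m : nat) (T : rmod A) (Z : 'I_m -> rmod A).
Hypotheses (T_pd1 : pd1 T) (T_rigid : ext1 T T).
Hypotheses (Z_indec : forall k, indecomposable (Z k))
  (Z_T : forall k, retract (Z k) T)
  (Z_uniq : forall k l, isom (Z k) (Z l) -> k = l).

(** The virtual dimension [hdim P0 X - hdim P1 X], computed on the resolutions of
    the [Z k], detects exactly the index [j] for a suitable [X]: with
    [u : T^n -> Z j] an approximation by the radical morphisms, [X] is the cokernel
    of [u] or, when [u] is onto, the quotient of the kernel of [u] by the trace of
    [T]. *)
Lemma test_module j : exists X, forall k (r : res (Z k)),
  (hdim (res0 r) X == hdim (res1 r) X) = (k != j).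
Proof.
(* The radical maps, as those through which no automorphism of [Z j] factors. *)
pose J (f : mor T (Z j)) := forall g : mor (Z j) T, ~ injective (compm f g).
have [n [u [uJ [fs [ps [fsJ uE]]]]]] := approximation J.
set B := bigdsum _ in u uJ ps uE.
(* Extended to [T] by a projection onto [Z k], such an [f] is radical; otherwise [Z j] would be a
   retract of [Z k]. *)
have u_fact k (f : mor (Z k) (Z j)) : k != j ->
    exists h : mor (Z k) B, forall x, u (h x) = f x.
  move=> kj; have [i [p ip]] := Z_T k.
  have [|h hE] := uJ (compm f p); last first.
    by exists (compm h i) => x /=; rewrite hE /= ip.
  move=> g /endo_bij[v [vK Kv]]; case/eqP: kj; apply: esym; apply: Z_uniq.
  apply: indec_retract (Z_indec k) _ _; first by have [] := Z_indec j.
  by exists (compm p g), (compm v f).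
(* By locality, an invertible [u \o s] would have an invertible term through one of the radical maps
   [fs k]. *)
have u_rad (s : mor (Z j) B) : ~ injective (compm u s).
  move=> us.
  have [|k kE] := @indec_local _ _ n (Z j)
    (fun k => compm (fs k) (compm (ps k) s)) (Z_indec j).
    by move=> x y /=; rewrite -!uE; apply: us.
  exact: (fsJ k (compm (ps k) s)).
have Z_pd1 k : pd1 (Z k) by apply: pd1_retract T_pd1.
have ZT k : ext1 (Z k) T by apply: ext1_retractl T_rigid.
have ZB k : ext1 (Z k) B by apply: ext1_bigdsumr => _.
have Z_gen k n' X (v : mor (bigdsum (fun _ : 'I_n' => T)) X) : surj v -> ext1 (Z k) X.
  by apply: ext1_quotient => //; apply: ext1_bigdsumr => _.
(* If [u] is not onto, its cokernel [X] has no Ext^1 from any [Z k], being a quotient of [Z j]. For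
   [k != j] maps [Z k -> X] lift to [Z j], hence factor through [u] and vanish, while [Z j -> X] is
   nonzero: the form is positive exactly at [j]. *)
have [us|us] := classic (surj u); last first.
  have [I [e [i [es ii ieE]]]] := image_fact u.
  have [X [p [psurj pE]]] := cokernel u.
  have s : ses i p.
    split=> // x; rewrite pE; split=> [[y ->] | [z ->]]; first by exists (e y).
    by have [y <-] := es z; exists y.
  have ZX k : ext1 (Z k) X.
    by apply: ext1_quotient psurj => //; apply: ext1_retractr (Z_T j) _.
  exists X => k; have [-> r | kj r] := eqVneq k j; last first.
    apply/eqP/hdim_res_eq => // f x.
    have [g gE] := ext1_lift f s (Z_gen k _ _ e es).
    have [h hE] := u_fact k g kj.
    by rewrite -gE; apply/pE; exists (h x).
  apply/negbTE; rewrite neq_ltn orbC hdim_res_gt // => p0.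
  by apply: us => y; have /pE[x ->] := p0 p y; exists x.
(* If [u] is onto, dividing its kernel [X] by the trace of [T] kills all maps from the [Z k], and
   the form at [X'] is minus the dimension of Ext^1. It is negative exactly at [j]. *)
have [X [i s]] := kernel_ses us.
have [n' [v [vE _]]] := approximation (fun _ : mor T X => True).
have [I [e [i' [es ii ieE]]]] := image_fact v.
have [X' [p [psurj pE]]] := cokernel v.
have s' : ses i' p.
  split=> // x; rewrite pE; split=> [[y ->] | [z ->]]; first by exists (e y).
  by have [y <-] := es z; exists y.
have ZX'0 k (f : mor (Z k) X') x : f x = 0.
  have [g gE] := ext1_lift f s' (Z_gen k _ _ e es).
  have [a [b ab]] := Z_T k.
  have [h hE] := vE (compm g b) Logic.I.
  by rewrite -gE; apply/pE; exists (h (a x)); rewrite hE /= ab.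
exists X' => k; have [-> r | kj r] := eqVneq k j; last first.
  apply/eqP/hdim_res_eq => //; apply: ext1_quotient psurj => // {}r f.
  (* [t] extends [i \o f] over [res0], and [u \o t] induces [w : Z k -> Z j]. As [w] factors through
     [u], subtracting that factorization moves [t] into the kernel [X]. *)
  have [t tE] := ZB k r (compm i f).
  have [_ ras rex] := res_ses r.
  have [|w wE] := @surj_fact _ _ _ _ _ (resa r) (compm u t) ras.
    by move=> x /rex[y ->]; rewrite /= tE /= (ses_comp s).
  have [h hE] := u_fact k w kj.
  have [|q qE] := ses_fact (h := subm t (compm h (resa r))) s.
    by move=> x; rewrite submE morB /= hE wE subrr.
  have [ii' _ _] := s; exists q => y; apply: ii'.
  by rewrite qE submE /= (ses_comp (res_ses r)) mor0 subr0 tE.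
(* Were Ext^1(Z j, X') zero, so would be Ext^1(Z j, X), and the identity of [Z j] would lift through
   [u]. *)
apply/negbTE; rewrite neq_ltn hdim_res_lt // => ZX'.
have ZX := ext1_middle s' (Z_gen j _ _ e es) ZX'.
have [g gE] := ext1_lift (idm (Z j)) s ZX.
by apply: (u_rad g) => x y /=; rewrite !gE.
Qed.

(** Evaluated at the test module of [j], the relation keeps only its [j]-th term. *)
Lemma res_independent (t : forall k, res (Z k)) (u : 'I_m -> rat) :
  (forall X, \sum_k u k * ((hdim (res0 (t k)) X)%:R - (hdim (res1 (t k)) X)%:R) = 0) ->
  forall j, u j = 0.
Proof.
move=> u0 j; have [X XE] := test_module j.
have := u0 X; rewrite (bigD1 j) //= big1 => [|k kj]; last first.
  by have := XE k (t k); rewrite kj => /eqP ->; rewrite subrr mulr0.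
rewrite addr0 => /eqP; rewrite mulf_eq0 => /orP[/eqP //|].
by rewrite subr_eq0 Num.Theory.eqr_nat XE eqxx.
Qed.

End TestModule.
End TestModules.

(** * Bongartz completion *)

Section Bongartz.
Variables (K : fieldType) (A : falgType K).
Implicit Types L M N X Y Z E P Q R T : rmod A.

Lemma isdsum_proj n M (X : 'I_n -> rmod A) i p (z : forall k, X k) l :
  @isdsum _ _ n M X i p -> p l (\sum_k i k (z k)) = z l.
Proof.
case=> h1 h2 _; rewrite mor_sum (bigD1 l) //= big1 ?addr0 => [|k kl]; first exact: h1.
by rewrite h2.
Qed.

Lemma isdsum_inj n M (X : 'I_n -> rmod A) i p (x y : M) :
  @isdsum _ _ n M X i p -> (forall k, p k x = p k y) -> x = y.
Proof.
by case=> _ _ h xy; rewrite [x]h [y]h; apply: eq_bigr => k _; rewrite xy.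
Qed.

(** [E] is the universal extension of a power of [M] by [R]: the pushout of
    [P1^n -> P0^n] along a basis of [Hom(P1, R)], [P1 -> P0] being the given
    resolution of [M]. *)
Lemma bongartz M R (r : res M) : pd1 M -> ext1 M M -> proj R ->
  exists E (rE : res E) n,
  [/\ pd1 E, ext1 M E, (forall X, ext1 M X -> ext1 E X) &
    forall X, hdim (res0 rE) X = (hdim R X + n * hdim (res0 r) X)%N
      /\ hdim (res1 rE) X = (n * hdim (res1 r) X)%N].
Proof.
move=> M1 MM Rp; have P1p := pd1_res (r := r) M1.
have [n [f [_ fspan]]] := mor_span (fun _ : mor (res1 r) R => True).
have [i [p S1]] := bigdsumP (fun _ : 'I_n => res1 r).
have [i0 [p0 S0]] := bigdsumP (fun _ : 'I_n => res0 r).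
move: i p S1 i0 p0 S0; set B1 := bigdsum _ => i p S1; set B0 := bigdsum _ => i0 p0 S0.
have [h1 h2 h3] := S1; have [k1 k2 k3] := S0.
pose D := dsum R B0.
pose w : mor B1 D :=
  subm (compm (dinl R B0) (summ (fun k => compm (f k) (p k))))
    (compm (dinr R B0) (summ (fun k => compm (i0 k) (compm (resd r) (p k))))).
have wE y : w y = (\sum_k f k (p k y), - \sum_k i0 k (resd r (p k y))).
  by rewrite submE; congr (_, _); rewrite /= ?subr0 ?sub0r.
have wi l u : w (i l u) = (f l u, - i0 l (resd r u)).
  rewrite wE (bigD1 l) //= (bigD1 l (P := xpredT)) //= h1 !big1 ?addr0 // => k kl;
    by rewrite h2 1?eq_sym // !mor0.
have [ri _ rex] := res_ses r.
have w_inj : injective w.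
  apply: linear_inj => y; rewrite [_ y]wE => -[_ /eqP]; rewrite oppr_eq0 => /eqP y0.
  apply: (isdsum_inj S1) => l; rewrite mor0; apply: ri; rewrite mor0.
  by rewrite -(isdsum_proj (fun k => resd r (p k y)) l S0) y0 mor0.
have [E [pi [pis piE]]] := cokernel w.
have ws : ses w pi by [].
have Dp : proj D.
  by apply: proj_bip (dsum_bip _ _) Rp _; apply: proj_bigdsum => _; apply: res_proj.
have B1p : proj B1 by apply: proj_bigdsum.
(* In the pushout [f l] becomes the differential into the [l]-th copy of [res0 r], a map that
   extends over [res0 r]. *)
have pi0 l u : pi (f l u, 0) = pi (0, i0 l (resd r u)).
  apply/eqP; rewrite -subr_eq0 -morB; apply/eqP/piE; exists (i l u).
  by rewrite wi; congr (_, _); rewrite /= ?subr0 ?sub0r.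
have ext_R (a : mor (res1 r) R) :
    exists h : mor (res0 r) E, forall y, h (resd r y) = pi (a y, 0).
  have [c cE] := fspan a Logic.I.
  exists (summ (fun k => scalem (c k) (compm pi (compm (dinr R B0) (i0 k))))) => y /=.
  have -> : ((a y, 0) : D) = \sum_k c k *: ((f k y, 0) : D).
    rewrite -[RHS]/(\sum_k c k *: dinl R B0 (f k y)) cE -[LHS]/(dinl R B0 _) mor_sum.
    by apply: eq_bigr => k _; rewrite morZ.
  by rewrite mor_sum; apply: eq_bigr => k _; rewrite morZ pi0.
exists E, (Res Dp ws), n; split.
- by exists (Res Dp ws).
- apply: (ext1_intro (r := r)) => g.
  (* Lift [g] to [D]; the component in [R] extends by [ext_R]. Rigidity of [M] splits each other
     component [b l] into a part [n' l] through the differential, which extends, and the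
     differential after [u l], which [pi0] turns into [f l \o u l], again a map to [R]. *)
  have [g' g'E] := P1p _ _ pi g pis.
  pose b l := compm (p0 l) (compm (dsnd R B0) g').
  have bE l : exists n' : mor (res0 r) (res0 r), exists u : mor (res1 r) (res1 r),
      forall y, b l y = n' (resd r y) + resd r (u y).
    have [t tE] := MM r (compm (resa r) (b l)).
    have [_ ras _] := res_ses r; have [n' n'E] := res_proj t ras.
    have [|u uE] := ses_fact (h := subm (b l) (compm n' (resd r))) (res_ses r).
      by move=> y; rewrite submE morB /= n'E tE /= subrr.
    by exists n', u => y; rewrite uE submE /= addrC subrK.
  have [n' /fin_all_exists[u nuE]] := fin_all_exists bE.
  have [h hE] := ext_R (compm (dfst R B0) g').
  have [hl hlE] := fin_all_exists (fun l => ext_R (compm (f l) (u l))).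
  exists (addm h (summ (fun l =>
    addm (compm pi (compm (dinr R B0) (compm (i0 l) (n' l)))) (hl l)))).
  move=> y; rewrite /= hE -g'E.
  have -> : g' y = dinl R B0 (g' y).1 + dinr R B0 (g' y).2.
    by case: (g' y) => a c; congr (_, _); rewrite /= ?addr0 ?add0r.
  rewrite morD; congr (_ + _).
  rewrite (k3 (g' y).2) !mor_sum; apply: eq_bigr => l _.
  rewrite -[p0 l _]/(b l y) nuE !morD; congr (_ + _).
  by rewrite hlE /= pi0.
- move=> X MX; apply: (ext1_intro (r := Res Dp ws)) => g.
  have [e eE] := fin_all_exists (fun k => MX r (compm g (i k))).
  (* Zero on [R]; the sign on [B0] is that of the second component of [w]. *)
  exists (scalem (-1) (compm (summ (fun k => compm (e k) (p0 k))) (dsnd R B0))) => y.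
  rewrite /= [in RHS](h3 y) mor_sum scaleN1r -sumrN; apply: eq_bigr => k _.
  have := congr1 snd (wE y); rewrite /= => ->.
  by rewrite !morN opprK (isdsum_proj (fun k => resd r (p k y)) k S0) eE.
move=> X; rewrite (hdim_bip _ (dsum_bip _ _)) (hdim_isdsum _ S0) (hdim_isdsum _ S1).
by rewrite !sum_nat_const card_ord.
Qed.

Lemma res_isdsum n M (X : 'I_n -> rmod A) i p (t : forall k, res (X k)) :
  @isdsum _ _ n M X i p -> exists r : res M, forall Z,
  hdim (res0 r) Z = (\sum_k hdim (res0 (t k)) Z)%N
  /\ hdim (res1 r) Z = (\sum_k hdim (res1 (t k)) Z)%N.
Proof.
move=> S; have [j1 [q1 S1]] := bigdsumP (fun k => res1 (t k)).
have [j0 [q0 S0]] := bigdsumP (fun k => res0 (t k)).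
pose d := summ (fun k => compm (j0 k) (compm (resd (t k)) (q1 k))).
pose a := summ (fun k => compm (i k) (compm (resa (t k)) (q0 k))).
have q0d l y : q0 l (d y) = resd (t l) (q1 l y).
  exact: (isdsum_proj (fun k => resd (t k) (q1 k y)) l S0).
have pa l x : p l (a x) = resa (t l) (q0 l x).
  exact: (isdsum_proj (fun k => resa (t k) (q0 k x)) l S).
have tses k := res_ses (t k).
have s : ses d a.
  split.
  - move=> x y xy; apply: (isdsum_inj S1) => l; have [di _ _] := tses l.
    by apply: di; rewrite -!q0d xy.
  - move=> m; have [x xE] := fin_all_exists (fun k => let: And3 _ s _ := tses k in s (p k m)).
    exists (\sum_k j0 k (x k)); apply: (isdsum_inj S) => l.
    by rewrite pa (isdsum_proj x l S0) xE.
  move=> x; split=> [ax0 | [y ->]].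
    have qx k : exists y, q0 k x = resd (t k) y.
      by have [_ _ ex] := tses k; apply/ex; rewrite -pa ax0 mor0.
    have [y yE] := fin_all_exists qx.
    exists (\sum_k j1 k (y k)); apply: (isdsum_inj S0) => l.
    by rewrite q0d (isdsum_proj y l S1).
  apply: (isdsum_inj S) => l; rewrite pa q0d mor0.
  exact: ses_comp (tses l) _.
have Sp : proj (bigdsum (fun k => res0 (t k))).
  by apply: proj_bigdsum => k; apply: res_proj.
by exists (Res Sp s) => Z; rewrite (hdim_isdsum _ S0) (hdim_isdsum _ S1).
Qed.

End Bongartz.

(** * Counting indecomposable summands by g-vectors *)

Section Counting.
Variables (K : fieldType) (A : falgType K).
Implicit Types L M N X Y Z E P Q R T : rmod A.

(** The witnesses behind [nb_summands T m], kept explicit because their g-vectors become the rows of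
    a matrix. *)
Definition skeleton T m (Z : 'I_m -> rmod A) :=
  [/\ forall k, indecomposable (Z k) /\ retract (Z k) T,
      forall k l, isom (Z k) (Z l) -> k = l &
      forall N, indecomposable N -> retract N T -> exists k, isom N (Z k)].

Lemma skeleton_exists T : exists m (Z : 'I_m -> rmod A), skeleton T Z.
Proof.
have [n [X [i [p [S Xi]]]]] := decomposition T.
have [m [s [s1 s2]]] := isom_representatives X.
have [h1 _ h3] := S; exists m, (fun k => X (s k)); split=> // [k|N Ni NT].
  by split=> //; exists (i (s k)), (p (s k)).
have [k Nk] := indec_retract_sum h3 Ni NT; have [l kl] := s2 k.
by exists l; apply: isom_trans kl; apply: indec_retract Nk => //; case: Ni.
Qed.

Lemma skeleton_decomposition T m (Z : 'I_m -> rmod A) M : skeleton T Z ->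
  (forall N, indecomposable N -> retract N M -> retract N T) ->
  exists n (s : 'I_n -> 'I_m) i p, @isdsum _ _ n M (fun k => Z (s k)) i p.
Proof.
move=> [_ _ ZT] MT; have [n [X [i [p [[h1 h2 h3] Xi]]]]] := decomposition M.
have XZ k : exists l, isom (X k) (Z l).
  by apply: ZT => //; apply: MT => //; exists (i k), (p k).
have [s /fin_all_exists[f /fin_all_exists[g fgK]]] := fin_all_exists XZ.
have fK k : cancel (f k) (g k) by case: (fgK k).
have gK k : cancel (g k) (f k) by case: (fgK k).
exists n, s, (fun k => compm (i k) (g k)), (fun k => compm (f k) (p k)); split.
- by move=> k x /=; rewrite h1 gK.
- by move=> k l kl x /=; rewrite h2 // mor0.
by move=> m'; rewrite [LHS]h3; apply: eq_bigr => k _; rewrite /= fK.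
Qed.

Lemma proj_res P : proj P -> exists r : res P,
  [/\ proj (res1 r), forall X, hdim (res0 r) X = hdim P X
    & forall X, hdim (res1 r) X = 0%N].
Proof.
move=> Pp; have s : ses (zerom zero_mod P) (idm P).
  split=> [x y _|y|x]; first exact: zero_mod_eq.
    by exists y.
  by split=> [/= -> | [y ->] //]; exists 0.
exists (Res Pp s); split=> //; first exact/proj_zero/zero_mod_zero.
move=> X; apply/eqP; rewrite dimv_eq0 -subv0.
apply/subvP => f _; rewrite memv0; apply/eqP/lfunP => x.
by rewrite (zero_mod_zero x) !linear0.
Qed.

Lemma pd1_proj P : proj P -> pd1 P.
Proof. by case/proj_res => r [? _ _]; exists r. Qed.

Section GVector.
Variables (n : nat) (P : 'I_n -> rmod A).
Hypothesis P_skel : skeleton (regular A) P.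

Lemma P_proj j : proj (P j).
Proof.
case: P_skel => Pi _ _; have [_ Pj] := Pi j.
by apply: proj_retract Pj _; apply: regular_proj.
Qed.

(** The g-vector: coordinates of the class of [res0] minus that of [res1] in the basis of
    indecomposable projectives, tested against every [X]. *)
Definition gvec M (v : 'rV[rat]_n) := forall (r : res M) X,
  (hdim (res0 r) X)%:R - (hdim (res1 r) X)%:R =
  \sum_j v 0 j * (hdim (P j) X)%:R :> rat.

Lemma gvec_intro M (v : 'rV_n) (r : res M) :
  (forall X, (hdim (res0 r) X)%:R - (hdim (res1 r) X)%:R =
    \sum_j v 0 j * (hdim (P j) X)%:R :> rat) -> gvec M v.
Proof.
move=> rv r' X; rewrite -rv; apply/eqP; rewrite subr_eq addrAC eq_sym subr_eq.
by rewrite -!natrD schanuel.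
Qed.

Lemma proj_hdim Q : proj Q -> exists v : 'rV[rat]_n, forall X,
  (hdim Q X)%:R = \sum_j v 0 j * (hdim (P j) X)%:R :> rat.
Proof.
move=> Qp; have [|m [s [i [p S]]]] := skeleton_decomposition (M := Q) P_skel.
  move=> N Ni NQ; have [k [f fs]] := free_cover Q.
  have [h hE] := Qp _ _ f (idm Q) fs.
  have Nk : retract N (freem A k) by apply: retract_trans NQ _; exists h, f.
  have [j [q [_ _ jq]]] := bigdsumP (fun _ : 'I_k => regular A).
  by have [] := indec_retract_sum jq Ni Nk.
(* The coordinates are the multiplicities of the [P j] in [Q]. *)
exists (\row_j (#|[pred k | s k == j]|)%:R) => X.
rewrite (hdim_isdsum _ S) (partition_big s xpredT) //= natr_sum.
apply: eq_bigr => j _; rewrite mxE (eq_bigr (fun=> hdim (P j) X)) => [|k /eqP -> //].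
by rewrite sum_nat_const natrM.
Qed.

Lemma gvec_exists M : pd1 M -> exists v, gvec M v.
Proof.
case=> r P1; have [v vE] := proj_hdim P1; have [u uE] := proj_hdim (@res_proj _ _ _ r).
exists (u - v); apply: (gvec_intro (r := r)) => X; rewrite uE vE -sumrB.
by apply: eq_bigr => j _; rewrite !mxE mulrBl.
Qed.

Lemma gvec_isdsum m M (X : 'I_m -> rmod A) i p (v : 'I_m -> 'rV_n) :
  @isdsum _ _ m M X i p -> (forall k, gvec (X k) (v k)) -> gvec M (\sum_k v k).
Proof.
move=> S Xv; have [t _] := fin_all_exists (fun k => res_exists (X k)).
have [r rE] := res_isdsum t S; apply: (gvec_intro (r := r)) => Y.
have [-> ->] := rE Y; rewrite !natr_sum -sumrB (eq_bigr _ (fun k _ => Xv k (t k) Y)).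
rewrite exchange_big; apply: eq_bigr => j _ /=.
by rewrite summxE mulr_suml.
Qed.

Section Independence.
Variables (m : nat) (T : rmod A) (Z : 'I_m -> rmod A) (G : 'M[rat]_(m, n)).
Hypotheses (T1 : pd1 T) (TT : ext1 T T) (Z_skel : skeleton T Z)
  (ZG : forall k, gvec (Z k) (row k G)).

(** A linear relation between g-vectors is one between Euler forms, which the test modules for [T]
    rule out. Hence a rigid module of projective dimension at most one has at most [n] classes of
    summands. *)
Lemma gmatrix_free : row_free G.
Proof.
have [Zi Zu _] := Z_skel.
rewrite -kermx_eq0; apply/rowV0P => u /sub_kermxP uG.
apply/rowP => j; rewrite mxE.
have [t _] := fin_all_exists (fun k => res_exists (Z k)).
apply: (res_independent T1 TT (fun k => proj1 (Zi k)) (fun k => proj2 (Zi k)) Zu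
  (t := t) (u := u 0)) => X.
transitivity (\sum_l (u *m G) 0 l * (hdim (P l) X)%:R); last first.
  by rewrite uG big1 // => l _; rewrite mxE mul0r.
under eq_bigr => k _ do rewrite ZG mulr_sumr.
rewrite exchange_big; apply: eq_bigr => l _; rewrite mxE mulr_suml.
by apply: eq_bigr => k _; rewrite !mxE mulrA.
Qed.

Lemma gvec_retract N : retract N T -> exists2 v, gvec N v & (v <= G)%MS.
Proof.
move=> NT; have [|l [s [i [p S]]]] := skeleton_decomposition (M := N) Z_skel.
  by move=> N' _ N'N; apply: retract_trans NT.
exists (\sum_k row (s k) G); first exact: (gvec_isdsum S).
by apply: summx_sub => k _; apply: row_sub.
Qed.

End Independence.

(** The same argument for the rigid module [regular A], each [P k] being resolved by itself; it
    makes g-vectors unique. *)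
Lemma hdim_independent (u : 'rV[rat]_n) :
  (forall X, \sum_l u 0 l * (hdim (P l) X)%:R = 0) -> u = 0.
Proof.
move=> u0; have [Pi Pu _] := P_skel.
have [t tE] := fin_all_exists (fun k => proj_res (@P_proj k)).
apply/rowP => j; rewrite mxE.
apply: (res_independent _ _ (fun k => proj1 (Pi k)) (fun k => proj2 (Pi k)) Pu
  (t := t) (u := u 0)) => [||X].
- exact/pd1_proj/regular_proj.
- exact/ext1_proj/regular_proj.
by rewrite -[RHS](u0 X); apply: eq_bigr => k _; have [_ -> ->] := tE k; rewrite subr0.
Qed.

Lemma bongartz_completion M : pd1 M -> ext1 M M ->
  exists T (Z : 'I_n -> rmod A), [/\ pd1 T, ext1 T T, retract M T & skeleton T Z].
Proof.
move=> M1 MM; have [r _] := res_exists M.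
have [E /fin_all_exists[rE /fin_all_exists[k kE]]] :=
  fin_all_exists (fun j => bongartz r M1 MM (@P_proj j)).
(* The completion is [M] together with its universal extensions by all [P j]; the extra index [ord0]
   holds [M]. *)
pose F (l : 'I_n.+1) := if unlift ord0 l is Some j then E j else M.
pose T := bigdsum F.
have E1 j : pd1 (E j) by case: (kE j).
have ME j : ext1 M (E j) by case: (kE j).
have EX j X : ext1 M X -> ext1 (E j) X by case: (kE j) => _ _ + _; apply.
have T1 : pd1 T by apply: pd1_bigdsum => l; rewrite /F; case: (unlift ord0 l).
have TT : ext1 T T.
  apply: ext1_bigdsuml => l; apply: ext1_bigdsumr => l'.
  by rewrite /F; case: (unlift ord0 l) => [j|]; case: (unlift ord0 l') => [j'|] //;
    apply: EX.
have FT l : retract (F l) T by have [i [p [h _ _]]] := bigdsumP F; exists (i l), (p l).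
have MT : retract M T by have := FT ord0; rewrite /F unlift_none.
have ET j : retract (E j) T by have := FT (lift ord0 j); rewrite /F liftK.
have [m [Z Zskel]] := skeleton_exists T.
have Z1 l : pd1 (Z l) by have [Zi _ _] := Zskel; apply: pd1_retract T1; case: (Zi l).
have [g gZ] := fin_all_exists (fun l => gvec_exists (Z1 l)).
pose G := \matrix_l g l.
have ZG l : gvec (Z l) (row l G) by rewrite rowK.
(* The extension gives [P j] = [E j] - k j [M], and both classes on the right lie in the row space.
   So the rows of [G] span, which gives [n <= m]. *)
have full : (1%:M <= G)%MS.
  apply/row_subP => j; rewrite row1.
  have [v vE vG] := gvec_retract Zskel ZG (ET j).
  have [w wM wG] := gvec_retract Zskel ZG MT.
  suff -> : delta_mx 0 j = v - (k j)%:R *: w.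
    by rewrite addmx_sub // -scaleNr scalemx_sub.
  apply/eqP; rewrite -subr_eq0; apply/eqP/hdim_independent => X.
  under eq_bigr => l _ do rewrite !mxE !mulrBl -mulrA.
  rewrite !sumrB -mulr_sumr -(vE (rE j)) -(wM r) (bigD1 j) //= big1 => [|l lj]; last first.
    by rewrite (negPf lj) mul0r.
  have [_ _ _ /(_ X)[-> ->]] := kE j.
  rewrite !eqxx mul1r addr0 natrD !natrM mulrBr.
  by rewrite -(addrA (hdim (P j) X)%:R) addrK subrr.
have mn : m = n.
  have /eqP rm := gmatrix_free T1 TT Zskel ZG.
  have := rank_leq_col G; have := mxrankS full; rewrite mxrank1 rm => nm mn.
  by apply/eqP; rewrite eqn_leq nm mn.
by case: n / mn Z Zskel {Z1 g gZ G ZG full} => Z Zskel; exists T, Z.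
Qed.

End GVector.

End Counting.

(** * From rigid modules to basic tilting modules *)

Section Tilting.
Variables (K : fieldType) (A : falgType K).
Implicit Types L M N X Y Z E P Q R T : rmod A.

Lemma surj_limg M N (f : mor M N) : surj f -> limg (linfun f) = fullv.
Proof.
move=> fs; apply/eqP; rewrite eqEsubv subvf /=; apply/subvP => y _.
by have [x <-] := fs y; rewrite -[f x](lfunE f) memv_img ?memvf.
Qed.

Lemma limg_surj M N (f : 'Hom(M, N)) : limg f = fullv -> forall y, exists x, f x = y.
Proof.
by move=> fs y; have := memvf y; rewrite -fs => /memv_imgP[x _ ->]; exists x.
Qed.

Section ShortResolution.
Variables (M : rmod A) (r : res M).
Hypothesis P1 : proj (res1 r).

Definition short_obj i : rmod A :=
  match i with 0%N => res0 r | 1%N => res1 r | _ => zero_mod end.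

Definition short_d i : 'Hom(short_obj i.+1, short_obj i) :=
  match i with 0%N => linfun (resd r) | _ => 0 end.

Fact short_projective i : projective (short_obj i).
Proof.
case: i => [|[|i]]; apply/projP => //=; first exact: res_proj.
exact/proj_zero/zero_mod_zero.
Qed.

Fact short_d_hom i : short_d i \in homv (short_obj i.+1) (short_obj i).
Proof. by case: i => [|i]; [apply: homv_mor | apply: mem0v]. Qed.

Fact short_exact0 : limg (short_d 0) = lker (linfun (resa r)).
Proof.
have [_ _ ex] := res_ses r; apply/vspaceP => x; rewrite memv_ker lfunE.
apply/memv_imgP/eqP => [[y _ ->] | /ex[y ->]]; first by rewrite lfunE; apply/ex; exists y.
by exists y; rewrite ?memvf //= lfunE.
Qed.

Fact short_exact i : limg (short_d i.+1) = lker (short_d i).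
Proof.
rewrite lim0g; case: i => [|i].
  have [di _ _] := res_ses r.
  by apply/esym/eqP/lker0P => x y; rewrite !lfunE; apply: di.
by apply/esym/vspaceP => x; rewrite (zero_mod_zero (x : zero_mod)) !mem0v.
Qed.

Definition short_resolution : proj_resolution M :=
  ProjResolution short_projective short_d_hom (homv_mor (resa r))
    (surj_limg (let: And3 _ s _ := res_ses r in s)) short_exact0 short_exact.

End ShortResolution.

Lemma pd1_pd_le M : pd1 M -> pd_le M 1.
Proof.
by case=> r P1; exists (short_resolution P1) => -[|[|i]] // _; apply: zero_mod_zero.
Qed.

Lemma ext1_Ext_vanishes M N : pd1 M -> ext1 M N -> Ext_vanishes 1 M N.
Proof.
case=> r P1 MN; exists (short_resolution P1) => f [fH _].
have [g gE] := MN r (mor_of_hom fH); exists (linfun g); first exact: homv_mor.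
by apply/lfunP => y; rewrite comp_lfunE lfunE /= lfunE gE.
Qed.

Lemma pd_le_pd1 M : pd_le M 1 -> pd1 M.
Proof.
case=> P P0; have s : ses (mor_of_hom (pres_d_hom P 0)) (mor_of_hom (pres_aug_hom P)).
  split.
  - apply: linear_inj => x /= dx0.
    have : x \in lker (pres_d P 0) by rewrite memv_ker dx0.
    by rewrite -pres_exact => /memv_imgP[y _ ->]; rewrite (P0 2%N isT y) linear0.
  - exact/limg_surj/pres_aug_surj.
  have e x : (pres_aug P x == 0) = (x \in limg (pres_d P 0)).
    by rewrite pres_exact0 memv_ker.
  move=> x /=; split=> [/eqP | [y ->]].
    by rewrite e => /memv_imgP[y _ ->]; exists y.
  by apply/eqP; rewrite e memv_img ?memvf.
have p0 := iffLR (projP _) (@pres_projective _ _ _ P 0).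
have p1 := iffLR (projP _) (@pres_projective _ _ _ P 1).
by exists (Res p0 s).
Qed.

(** Bongartz's module may repeat summands; one copy of each gives its basic version. *)
Lemma skeleton_bigdsum T m (Z : 'I_m -> rmod A) : skeleton T Z -> 
  [/\ basic (bigdsum Z), nb_summands (bigdsum Z) m,
      pd1 T -> pd1 (bigdsum Z), ext1 T T -> ext1 (bigdsum Z) (bigdsum Z)
    & forall N, indecomposable N -> retract N T -> retract N (bigdsum Z)].
Proof.
move=> [Zi Zu ZT]; have [i [p [h1 h2 h3]]] := bigdsumP Z.
have Zr k : retract (Z k) (bigdsum Z) by exists (i k), (p k).
split.
- exists m, Z; split=> [k|k l /isoP /Zu //|]; first by case: (Zi k).
  by apply/isoP/isom_refl.
- exists Z; split=> [k|k l /isoP /Zu //|N Ni /summand_retract NZ].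
    by split; [case: (Zi k) | apply/summand_retract].
  have [k Nk] := indec_retract_sum h3 Ni NZ.
  exists k; apply/isoP/(indec_retract _ _ Nk); first by case: (Zi k).
  by case: Ni.
- by move=> T1; apply: pd1_bigdsum => k; apply: pd1_retract T1; case: (Zi k).
- move=> TT; apply: ext1_bigdsuml => k; apply: ext1_bigdsumr => l.
  apply: ext1_retractl (proj2 (Zi k)) _; exact: ext1_retractr (proj2 (Zi l)) TT.
by move=> N Ni /ZT[|k /isom_retract Nk] //; apply: retract_trans (Zr k).
Qed.

Lemma skeleton_nb_summands T m (Z : 'I_m -> rmod A) : skeleton T Z -> nb_summands T m.
Proof.
move=> [Zi Zu ZT]; exists Z; split=> [k|k l /isoP /Zu //|N Ni /summand_retract NT].
  by have [? ?] := Zi k; split=> //; apply/summand_retract.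
by have [k /isoP Nk] := ZT N Ni NT; exists k.
Qed.

Lemma basic_tilting_completion M : indecomposable M -> pd1 M -> ext1 M M ->
  exists T, [/\ basic T, tilting T & retract M T].
Proof.
move=> Mi M1 MM; have [n [P Pskel]] := skeleton_exists (regular A).
have [T [Z [T1 TT MT Zskel]]] := bongartz_completion Pskel M1 MM.
have [b nb ZT1 ZTT Zr] := skeleton_bigdsum Zskel.
exists (bigdsum Z); split=> //; last exact: Zr.
split; [exact/pd1_pd_le/ZT1 | by apply: ext1_Ext_vanishes; auto |].
by exists n => //; apply: skeleton_nb_summands Pskel.
Qed.

Lemma finitely_many_rigid :
  finitely_many_classes (fun T : rmod A => basic T /\ tilting T) ->
  finitely_many_classes (fun M : rmod A => [/\ indecomposable M, pd1 M & ext1 M M]).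
Proof.
move=> [n [X XT]].
have [m /fin_all_exists[Z Zskel]] := fin_all_exists (fun k => skeleton_exists (X k)).
(* The index set of all indecomposable summands of all the finitely many tilting modules [X k]. *)
pose S := {k : 'I_n & 'I_(m k)}.
exists #|{: S}|, (fun s => Z (tag (enum_val s)) (tagged (enum_val s))) => M [Mi M1 MM].
have [T [Tb Tt MT]] := basic_tilting_completion Mi M1 MM.
have [k /isoP/isom_retract TX] := XT T (conj Tb Tt).
have [_ _ /(_ M Mi (retract_trans MT TX))[l Ml]] := Zskel k.
exists (enum_rank (Tagged (fun k => 'I_(m k)) l : S)); apply/isoP.
by rewrite enum_rankK.
Qed.

End Tilting.

(** * The transpose *)

Section Transpose.
Variables (K : fieldType) (A : falgType K).
Implicit Types L M N X Y P Q : rmod A.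

Lemma star_val0 M x : star_val (0 : star M) x = 0.
Proof. by rewrite /star_val linear0 zero_lfunE. Qed.

Lemma star_valB M (f g : star M) x : star_val (f - g) x = star_val f x - star_val g x.
Proof. by rewrite -[- g]scaleN1r addrC star_valP scaleN1r addrC. Qed.

Lemma star_val_sum M n (f : 'I_n -> star M) x :
  star_val (\sum_k f k) x = \sum_k star_val (f k) x.
Proof. by rewrite /star_val linear_sum sum_lfunE. Qed.

Lemma star_val_act M (f : star M) (a : A) x :
  star_val (ract f (a : A^c)) x = a * star_val f x.
Proof. exact: star_actE. Qed.

Definition star_mor M (f : star M) : mor M (regular A) := mor_of_hom (subvsP f).

Lemma star_val_ract M (f : star M) x a : star_val f (ract x a) = star_val f x * a.
Proof. exact: (mor_ract (star_mor f) x a). Qed.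

Definition mor_star M (f : mor M (regular A)) : star M :=
  vsproj (homv M (regular A)) (linfun f).

Lemma mor_starE M (f : mor M (regular A)) x : star_val (mor_star f) x = f x.
Proof. rewrite /star_val vsprojK; [exact: (@lfunE _ _ (regular A) f x) | exact: homv_mor]. Qed.

Lemma mor_star_comp M N (g : mor M N) (f : star N) x :
  star_val (mor_star (compm (star_mor f) g)) x = star_val f (g x).
Proof. exact: mor_starE. Qed.

Fact dualm_linear M N (g : mor M N) :
  linear (fun f : star N => mor_star (compm (star_mor f) g)).
Proof.
move=> k f f'; apply: star_ext => x.
by rewrite star_valP !mor_star_comp star_valP.
Qed.

Fact dualm_ract M N (g : mor M N) (f : star N) (a : A^c) :
  mor_star (compm (star_mor (ract f a)) g) = ract (mor_star (compm (star_mor f) g)) a.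
Proof.
by apply: star_ext => x; rewrite star_val_act !mor_star_comp star_val_act.
Qed.

(** The functor Hom(-, A) on morphisms. *)
Definition dualm M N (g : mor M N) : mor (star N) (star M) :=
  Mor (dualm_linear g) (dualm_ract g).

Lemma dualmE M N (g : mor M N) f x : star_val (dualm g f) x = star_val f (g x).
Proof. exact: mor_star_comp. Qed.

Lemma dualm_sub M N (g h : mor M N) f : dualm (subm g h) f = dualm g f - dualm h f.
Proof.
apply: star_ext => x; rewrite star_valB !dualmE submE.
exact: (morB (star_mor f)).
Qed.

Lemma dualm_comp L M N (g : mor M N) (h : mor L M) f :
  dualm (compm g h) f = dualm h (dualm g f).
Proof. by apply: star_ext => x; rewrite !dualmE. Qed.

Lemma dualm_zero M N (g : mor M N) f : (forall x, g x = 0) -> dualm g f = 0.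
Proof.
move=> g0; apply: star_ext => x; rewrite dualmE g0 star_val0.
exact: (mor0 (star_mor f)).
Qed.

Lemma star_dual_basis P : proj P ->
  exists n (x : 'I_n -> P) (phi : 'I_n -> star P),
    (forall y, y = \sum_k ract (x k) (star_val (phi k) y)) /\
    forall f : star P, f = \sum_k ract (phi k) (star_val f (x k) : A^c).
Proof.
move=> /dual_basis[n [x [phi xphi]]].
exists n, x, (fun k => mor_star (phi k)); split=> [y | f].
  by rewrite {1}[y]xphi; apply: eq_bigr => k _; rewrite mor_starE.
apply: star_ext => y; rewrite star_val_sum {1}[y]xphi linear_sum.
by apply: eq_bigr => k _; rewrite star_val_act mor_starE -star_val_ract.
Qed.

Lemma star_proj P : proj P -> proj (star P).
Proof.
move=> /star_dual_basis[n [x [phi [_ phiE]]]] M N g f gs.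
have [m mE] := fin_all_exists (fun k => gs (f (phi k))).
have h_lin : linear (fun u : star P => \sum_k ract (m k) (star_val u (x k) : A^c)).
  move=> c u v; rewrite scaler_sumr -big_split; apply: eq_bigr => k _.
  by rewrite star_valP; apply: (ract_linearr (m k)).
have h_act (u : star P) (a : A^c) :
    \sum_k ract (m k) (star_val (ract u a) (x k) : A^c) =
    ract (\sum_k ract (m k) (star_val u (x k) : A^c)) a.
  rewrite ract_sum; apply: eq_bigr => k _.
  by rewrite -ractM star_val_act.
exists (Mor h_lin h_act) => u.
rewrite /= mor_sum {2}[u]phiE mor_sum; apply: eq_bigr => k _.
by rewrite !mor_ract mE.
Qed.

Fact theta_linear P X (phi : star P) (m : X) :
  linear (fun y : P => ract m (star_val phi y)).
Proof. by move=> k x y; rewrite linearP ractDr ractZr. Qed.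
Fact theta_ract P X (phi : star P) (m : X) (y : P) a :
  ract m (star_val phi (ract y a)) = ract (ract m (star_val phi y)) a.
Proof. by rewrite star_val_ract ractM. Qed.
(** The image of the tensor of [m] and [phi] in Hom(P, X); for projective [P] such maps span, by the
    dual basis. *)
Definition theta P X (phi : star P) (m : X) : mor P X :=
  Mor (theta_linear phi m) (theta_ract phi m).

Fact cotheta_linear P (T : rmod A^c) (x : P) (t : T) :
  linear (fun f : star P => ract t (star_val f x : A^c)).
Proof. by move=> k f g; rewrite star_valP; apply: (ract_linearr t). Qed.
Fact cotheta_ract P (T : rmod A^c) (x : P) (t : T) (f : star P) (a : A^c) :
  ract t (star_val (ract f a) x : A^c) = ract (ract t (star_val f x : A^c)) a.
Proof. by rewrite star_val_act -ractM. Qed.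
(** The image of the tensor of [x] and [t] in Hom(star P, T). *)
Definition cotheta P (T : rmod A^c) (x : P) (t : T) : mor (star P) T :=
  Mor (cotheta_linear x t) (cotheta_ract x t).

(** The values of [f] on a dual basis determine it, and used as coordinates they define [g]. *)
Lemma star_full P Q (f : mor (star P) (star Q)) : proj P ->
  exists g : mor Q P, forall u, f u = dualm g u.
Proof.
move=> /star_dual_basis[n [x [phi [_ phiE]]]].
exists (summ (fun k => theta (f (phi k)) (x k))) => u; apply: star_ext => y.
rewrite dualmE [in LHS](phiE u) mor_sum star_val_sum linear_sum.
by apply: eq_bigr => k _; rewrite mor_ract star_val_act /= star_val_ract.
Qed.

Lemma star_faithful P Q (g g' : mor Q P) : proj P ->
  (forall u, dualm g u = dualm g' u) -> forall y, g y = g' y.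
Proof.
move=> /star_dual_basis[n [x [phi [xE _]]]] gg' y.
rewrite (xE (g y)) [RHS]xE; apply: eq_bigr => k _.
by rewrite -!dualmE gg'.
Qed.

(** A balanced form on [M] and [T] is the same as a morphism from [M] to the dual of [T]. *)
Lemma balanced_zero M (T : rmod A^c) (b : M -> T -> K^o) :
  (forall m, linear (b m)) -> (forall t, linear (b^~ t)) ->
  (forall m t (a : A), b (ract m a) t = b m (ract t (a : A^c))) ->
  (forall (h : mor M (kdual T)) m, h m = 0) -> forall m t, b m t = 0.
Proof.
move=> blin1 blin2 bal h0 m t.
pose bL m : {linear T -> K^o} :=
  HB.pack (b m) (GRing.isLinear.Build K T K^o *:%R (b m) (blin1 m)).
have bE m' t' : linfun (bL m') t' = b m' t' by rewrite lfunE.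
have h_lin : linear (fun m => linfun (bL m) : kdual T).
  move=> k x y; apply/lfunP => s; rewrite bE.
  by rewrite add_lfunE scale_lfunE !bE blin2.
have h_act (x : M) a : linfun (bL (ract x a)) = ract (linfun (bL x) : kdual T) a.
  by apply/lfunP => s; rewrite bE bal [RHS]kdual_actE bE.
by rewrite -bE -[linfun _]/(@Mor _ _ M (kdual T) _ h_lin h_act m) h0 zero_lfunE.
Qed.

(** The data of [is_transpose M T], keeping only the minimality of [P1 -> im d]. *)
Record transp M (T : rmod A^c) := Transp {
  tp1 : rmod A;
  tp0 : rmod A;
  tpd : mor tp1 tp0;
  tpa : mor tp0 M;
  tpq : mor (star tp1) T;
  tp1_proj : proj tp1;
  tp0_proj : proj tp0;
  tpa_surj : surj tpa;
  tp_exact : forall x, tpa x = 0 <-> exists y, x = tpd y;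
  tpq_surj : surj tpq;
  tpq_exact : forall f, tpq f = 0 <-> exists g, f = dualm tpd g;
  tpd_min : superfluous (lker (linfun tpd))
}.

Section TauRigid.
Variables (M : rmod A) (T : rmod A^c) (D : transp M T).
Hypothesis hom0 : forall (h : mor M (kdual T)) m, h m = 0.

(** A linear form [l] on Hom(P1, M) that kills the image of Hom(P0, M) induces, through [theta], a
    balanced form on [M] and [T]. That form is zero, and the maps [theta] span Hom(P1, M). *)
Lemma tau_rigid_extends (f : mor (tp1 D) M) :
  exists g : mor (tp0 D) M, forall y, f y = g (tpd D y).
Proof.
pose W := (precomp M (tpd D) @: homv (tp0 D) M)%VS.
have [/precomp_img[g _ gE]|fW] := boolP (linfun f \in W).
  by exists g => y; rewrite -gE lfunE.
have [l lW] := separating_functional fW; case/eqP.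
(* [s] is only $K$-linear, but by [b0q] the value of [b0] depends on [phi] through its class in [T]
   alone, so [s] may be treated as $A$-linear inside [b0]. *)
have [s sK] := lin_inv_surj (@tpq_surj _ _ D).
pose b0 m (phi : star (tp1 D)) : K^o := l (linfun (theta phi m)).
have b0lin m : linear (b0 m).
  move=> k u v; rewrite /b0 -linearP; congr (l _); apply/lfunP => y.
  by rewrite add_lfunE scale_lfunE !lfunE /= star_valP ractDr ractZr.
have b0lin2 phi : linear (b0^~ phi).
  move=> k u v; rewrite /b0 -linearP; congr (l _); apply/lfunP => y.
  by rewrite add_lfunE scale_lfunE !lfunE /= ractD ractZ.
pose b0L m : {linear star (tp1 D) -> K^o} :=
  HB.pack (b0 m) (GRing.isLinear.Build K _ K^o *:%R (b0 m) (b0lin m)).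
have b0q m u v : tpq D u = tpq D v -> b0 m u = b0 m v.
  move=> /eqP; rewrite -subr_eq0 -morB => /eqP/tpq_exact[g uvg].
  apply/eqP; rewrite -subr_eq0 -[b0 m u]/(b0L m u) -[b0 m v]/(b0L m v) -linearB uvg.
  apply/eqP/lW/precomp_img; exists (theta g m) => // y.
  by rewrite lfunE /= dualmE.
have b00 m t : b0 m (s t) = 0.
  apply: (balanced_zero (b := fun m t => b0 m (s t))) hom0 m t => [m k u v|t|m t a].
  - by rewrite linearP b0lin.
  - exact: b0lin2.
  have -> : b0 m (s (ract t (a : A^c))) = b0 m (ract (s t) (a : A^c)).
    by apply: b0q; rewrite mor_ract !sK.
  by congr (l _); apply/lfunP => y; rewrite !lfunE /= star_val_act ractM.
have [n [x [phi [xE _]]]] := star_dual_basis (@tp1_proj _ _ D).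
have -> : linfun f = \sum_k linfun (theta (phi k) (f (x k))).
  apply/lfunP => y; rewrite sum_lfunE [LHS]lfunE [LHS]/= [in LHS](xE y) mor_sum.
  by apply: eq_bigr => k _; rewrite mor_ract lfunE.
rewrite linear_sum big1 // => k _.
by rewrite -[LHS]/(b0 _ _) -(b00 (f (x k)) (tpq D (phi k))); apply: b0q; rewrite sK.
Qed.

(** The mirror image of [tau_rigid_extends]: now [M] is replaced by its cover P0, and [cotheta]
    spans Hom(star P0, T). *)
Lemma tau_rigid_transpose_extends (f : mor (star (tp0 D)) T) :
  exists g : mor (star (tp1 D)) T, forall u, f u = g (dualm (tpd D) u).
Proof.
pose W := (precomp T (dualm (tpd D)) @: homv (star (tp1 D)) T)%VS.
have [/precomp_img[g _ gE]|fW] := boolP (linfun f \in W).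
  by exists g => y; rewrite -gE lfunE.
have [l lW] := separating_functional fW; case/eqP.
have [s sK] := lin_inv_surj (@tpa_surj _ _ D).
pose b0 (x : tp0 D) t : K^o := l (linfun (cotheta x t)).
have b0lin t : linear (b0^~ t).
  move=> k u v; rewrite /b0 -linearP; congr (l _); apply/lfunP => y.
  by rewrite add_lfunE scale_lfunE !lfunE /= linearP -ractZr -ractDr.
have b0lin2 x : linear (b0 x).
  move=> k u v; rewrite /b0 -linearP; congr (l _); apply/lfunP => y.
  by rewrite add_lfunE scale_lfunE !lfunE /= ractD ractZ.
pose b0L t : {linear tp0 D -> K^o} :=
  HB.pack (b0^~ t) (GRing.isLinear.Build K _ K^o *:%R (b0^~ t) (b0lin t)).
have b0q t u v : tpa D u = tpa D v -> b0 u t = b0 v t.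
  move=> /eqP; rewrite -subr_eq0 -morB => /eqP/tp_exact[y uvy].
  apply/eqP; rewrite -subr_eq0 -[b0 u t]/(b0L t u) -[b0 v t]/(b0L t v) -linearB uvy.
  apply/eqP/lW/precomp_img; exists (cotheta y t) => // w.
  by rewrite lfunE /= dualmE.
have b00 m t : b0 (s m) t = 0.
  apply: (balanced_zero (b := fun m t => b0 (s m) t)) hom0 m t => [m|t k u v|m t a].
  - exact: b0lin2.
  - by rewrite linearP b0lin.
  have -> : b0 (s (ract m a)) t = b0 (ract (s m) a) t.
    by apply: b0q; rewrite mor_ract !sK.
  by congr (l _); apply/lfunP => y; rewrite !lfunE /= star_val_ract -ractM.
have [n [x [phi [_ phiE]]]] := star_dual_basis (@tp0_proj _ _ D).
have -> : linfun f = \sum_k linfun (cotheta (x k) (f (phi k))).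
  apply/lfunP => u; rewrite sum_lfunE [LHS]lfunE [LHS]/= [in LHS](phiE u) mor_sum.
  by apply: eq_bigr => k _; rewrite mor_ract lfunE.
rewrite linear_sum big1 // => k _.
by rewrite -[LHS]/(b0 _ _) -(b00 (tpa D (x k)) (f (phi k))); apply: b0q; rewrite sK.
Qed.

Lemma tau_rigid_ext1 : ext1 M M.
Proof.
have [L [i s]] := kernel_ses (@tpa_surj _ _ D); have [ii _ ex] := s.
apply: (ext1_intro (r := Res (@tp0_proj _ _ D) s)) => f.
(* [e] maps [tp1] onto the syzygy [L], so an extension of [f \o e] along [tpd D] is an extension of
   [f] along [i]. *)
have [|e eE] := ses_fact (h := tpd D) s.
  by move=> y; apply/tp_exact; exists y.
have [g gE] := tau_rigid_extends (compm f e); exists g => y.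
have /tp_exact[z zE] : tpa D (i y) = 0 by apply/ex; exists y.
have -> : y = e z by apply: ii; rewrite eE.
by rewrite eE -gE.
Qed.

End TauRigid.
End Transpose.

(** * Recovering modules with zero dual from their transposes *)

Section TransposeFunctor.
Variables (K : fieldType) (A : falgType K).
Implicit Types (L M N X Y P Q : rmod A) (T : rmod A^c).

Definition star_zero M := forall (f : mor M (regular A)) x, f x = 0.

Section Dual.
Variables (M : rmod A) (T : rmod A^c) (D : transp M T).
Hypothesis M0 : star_zero M.

(** A functional on P0 that kills the image of P1 factors through [M], hence is zero. *)
Lemma dualm_tpd_inj : injective (dualm (tpd D)).
Proof.
apply: linear_inj => u u0.
have [|f fE] := @surj_fact _ _ (regular A) _ _ (tpa D) (star_mor u) (@tpa_surj _ _ _ _ D).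
  move=> x /tp_exact[y ->].
  by rewrite -[LHS]/(star_val u (tpd D y)) -dualmE u0 star_val0.
by apply: star_ext => x; rewrite -[LHS]/(star_mor u x) -fE M0 star_val0.
Qed.

Lemma dualm_ses : ses (dualm (tpd D)) (tpq D).
Proof.
by split; [exact: dualm_tpd_inj | exact: tpq_surj | exact: tpq_exact].
Qed.

(** Dualizing exchanges the degrees: the dual of P1 covers [T], and the dual of P0 is the syzygy. *)
Definition tp_res : res T := Res (star_proj (@tp1_proj _ _ _ _ D)) dualm_ses.

Lemma transpose_pd1 : pd1 T.
Proof. by exists tp_res; apply/star_proj/tp0_proj. Qed.

Lemma transpose_ext1 :
  (forall (h : mor M (kdual T)) m, h m = 0) -> ext1 T T.
Proof.
move=> h0; apply: (ext1_intro (r := tp_res)) => f.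
by have [g gE] := tau_rigid_transpose_extends h0 f; exists g => u; rewrite gE.
Qed.

End Dual.

(** [lifts D D' f m]: [f : T -> T'] and [m : M' -> M] are induced by a common
    morphism of presentations.  When the duals of [M] and [M'] vanish this is the
    graph of a contravariant additive functor from transposes back to modules. *)
Definition lifts M T (D : transp M T) M' T' (D' : transp M' T')
    (f : mor T T') (m : mor M' M) :=
  exists (k1 : mor (tp1 D') (tp1 D)) (k0 : mor (tp0 D') (tp0 D)),
  [/\ forall u, tpq D' (dualm k1 u) = f (tpq D u),
      forall y, k0 (tpd D' y) = tpd D (k1 y)
    & forall x, tpa D (k0 x) = m (tpa D' x)].

Lemma lifts_exists M T (D : transp M T) M' T' (D' : transp M' T') (f : mor T T') :
  star_zero M -> star_zero M' -> exists m, lifts D D' f m.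
Proof.
move=> M0 M0'.
(* Lift [f] to the resolutions of the transposes, pull the lifts back by fullness and their
   commutation by faithfulness, and take the map induced on cokernels. *)
have [h1 [h0 [h1E h0E]]] := comparison (tp_res D M0) (tp_res D' M0') f.
have [k1 k1E] := star_full h1 (@tp1_proj _ _ _ _ D).
have [k0 k0E] := star_full h0 (@tp0_proj _ _ _ _ D).
have k01 y : k0 (tpd D' y) = tpd D (k1 y).
  apply: (star_faithful (g := compm k0 (tpd D')) (g' := compm (tpd D) k1)) y.
    exact: tp0_proj.
  move=> u; apply: star_ext => y; rewrite !dualmE /=.
  by rewrite -!dualmE -k0E -k1E; have := h0E u; rewrite /= => ->.
have [|m mE] := @surj_fact _ _ M _ _ (tpa D') (compm (tpa D) k0) (@tpa_surj _ _ _ _ D').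
  by move=> x /tp_exact[y ->]; rewrite /= k01; apply/tp_exact; exists (k1 y).
exists m, k1, k0; split=> // u.
by have := h1E u; rewrite /= k1E.
Qed.

Lemma lifts_id M T (D : transp M T) : lifts D D (idm T) (idm M).
Proof.
exists (idm _), (idm _); split=> // u; congr (tpq D _).
by apply: star_ext => x; rewrite dualmE.
Qed.

Lemma lifts_comp M T (D : transp M T) M' T' (D' : transp M' T') M'' T'' (D'' : transp M'' T'')
    f m f' m' :
  lifts D D' f m -> lifts D' D'' f' m' -> lifts D D'' (compm f' f) (compm m m').
Proof.
move=> [k1 [k0 [h1 h2 h3]]] [l1 [l0 [g1 g2 g3]]].
exists (compm k1 l1), (compm k0 l0); split=> [u|y|x].
- by rewrite dualm_comp g1 h1.
- by rewrite /= g2 h2.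
by rewrite /= h3 g3.
Qed.

Lemma lifts_sub M T (D : transp M T) M' T' (D' : transp M' T') f m f' m' :
  lifts D D' f m -> lifts D D' f' m' -> lifts D D' (subm f f') (subm m m').
Proof.
move=> [k1 [k0 [h1 h2 h3]]] [l1 [l0 [g1 g2 g3]]].
exists (subm k1 l1), (subm k0 l0); split=> [u|y|x].
- by rewrite submE -h1 -g1 -morB dualm_sub.
- by rewrite !submE h2 g2 morB.
by rewrite !submE morB h3 g3.
Qed.

Lemma lifts_zero M T (D : transp M T) M' T' (D' : transp M' T') f m :
  star_zero M' -> lifts D D' f m -> (forall t, f t = 0) -> forall x, m x = 0.
Proof.
move=> M0' [k1 [k0 [h1 h2 h3]]] f0.
(* For [f = 0] the lift is null-homotopic. Fullness turns the homotopy [s] into [t : P0' -> P1], and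
   [k0 = tpd D \o t] induces zero on cokernels. *)
have [|s sE] := ses_fact (h := dualm k1) (dualm_ses D' M0').
  by move=> u; rewrite h1 f0.
have [t tE] := star_full s (@tp1_proj _ _ _ _ D).
have k1t y : k1 y = t (tpd D' y).
  apply: (star_faithful (g := k1) (g' := compm t (tpd D'))) y; first exact: tp1_proj.
  move=> u; rewrite -sE tE; apply: star_ext => y; by rewrite !dualmE.
have k0t x : k0 x = tpd D (t x).
  apply: (star_faithful (g := k0) (g' := compm (tpd D) t)) x; first exact: tp0_proj.
  move=> u; apply: (dualm_tpd_inj (D := D')) => //; apply: star_ext => y.
  by rewrite !dualmE /= h2 k1t.
move=> x; have [x' <-] := @tpa_surj _ _ _ _ D' x.
by rewrite -h3 k0t; apply/tp_exact; exists (t x').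
Qed.

Lemma lifts_unique M T (D : transp M T) M' T' (D' : transp M' T') f m f' m' :
  star_zero M' -> lifts D D' f m -> lifts D D' f' m' -> f =1 f' -> m =1 m'.
Proof.
move=> M0' l l' ff' x; apply/eqP; rewrite -subr_eq0 -submE; apply/eqP.
apply: (lifts_zero M0' (lifts_sub l l')) => t.
by rewrite submE ff' subrr.
Qed.

Lemma transpose_reflects_isom M T (D : transp M T) M' T' (D' : transp M' T') :
  star_zero M -> star_zero M' -> isom T T' -> isom M M'.
Proof.
move=> M0 M0' [f [g [fK gK]]].
have [m ml] := lifts_exists D D' f M0 M0'; have [m' ml'] := lifts_exists D' D g M0' M0.
exists m', m; split.
  exact: (lifts_unique M0 (lifts_comp ml ml') (lifts_id D) fK).
exact: (lifts_unique M0' (lifts_comp ml' ml) (lifts_id D') gK).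
Qed.

Lemma idempotent_indec M (m : mor M M) : indecomposable M ->
  (forall x, m (m x) = m x) -> (forall x, m x = 0) \/ forall x, m x = x.
Proof.
move=> Mi mm; have [I [e [i [es ii ie]]]] := image_fact m.
have ei : cancel i e.
  by move=> z; have [x <-] := es z; apply: ii; rewrite !ie.
have [I0|I0] := classic (is_zero I).
  by left=> x; rewrite -ie (I0 (e x)) mor0.
by right=> x; rewrite -ie; apply: (indec_split Mi I0 ei).
Qed.

(** The morphism [k1 - t d] of the presentation inducing [e] is killed by [d], so
    its square is an idempotent with image in the superfluous kernel of [d]. *)
Lemma lifts_idempotent_zero M T (D : transp M T) (e : mor T T) m :
  lifts D D e m -> (forall t, e (e t) = e t) -> (forall x, m x = 0) ->
  forall t, e t = 0.
Proof.
move=> [k1 [k0 [h1 h2 h3]]] ee m0.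
have [L [i s]] := kernel_ses (@tpa_surj _ _ _ _ D); have [ii _ ex] := s.
have [|d' d'E] := ses_fact (h := tpd D) s; first by move=> y; apply/tp_exact; exists y.
have [|k k'E] := ses_fact (h := k0) s; first by move=> x; rewrite h3 m0.
have d's : surj d'.
  move=> z; have /tp_exact[y yE] : tpa D (i z) = 0 by apply/ex; exists z.
  by exists y; apply: ii; rewrite d'E.
(* As [m = 0], [k0] lands in the image of the differential and lifts to P1. *)
have [t tE] := @tp0_proj _ _ _ _ D _ _ d' k d's.
have {}tE x : tpd D (t x) = k0 x by rewrite -d'E tE k'E.
pose u := subm k1 (compm t (tpd D)).
have du y : tpd D (u y) = 0 by rewrite submE morB /= tE h2 subrr.
have qu v : tpq D (dualm u v) = e (tpq D v).
  rewrite dualm_sub dualm_comp.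
  rewrite morB h1 (_ : tpq D (dualm (tpd D) _) = 0) ?subr0 //.
  by apply/tpq_exact; exists (dualm t v).
have ud v g : v = dualm (tpd D) g -> dualm u v = 0.
  by move=> ->; rewrite -dualm_comp dualm_zero.
have ue v w : tpq D v = tpq D w -> dualm u v = dualm u w.
  move=> /eqP; rewrite -subr_eq0 -morB => /eqP/tpq_exact[g /ud].
  by rewrite morB => /eqP; rewrite subr_eq0 => /eqP.
have uuu y : u (u (u y)) = u (u y).
  apply: (star_faithful (g := compm u (compm u u)) (g' := compm u u)) y.
    exact: tp1_proj.
  by move=> v; rewrite !dualm_comp; apply: ue; rewrite !qu ee.
have uu0 y : u (u y) = 0.
  have kerP x : (x \in lker (linfun (compm u u))) = (u (u x) == 0).
    by rewrite memv_ker lfunE.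
  apply/eqP; rewrite -kerP.
  suff -> : lker (linfun (compm u u)) = fullv by apply: memvf.
  apply: tpd_min => [x a|].
    by rewrite !kerP !mor_ract => /eqP ->; rewrite ract0.
  apply/eqP; rewrite eqEsubv subvf /=; apply/subvP => x _.
  rewrite -[x](subrK (u (u x))) addrC; apply: memv_add.
    by rewrite memv_ker lfunE /= du.
  by rewrite kerP !morB !uuu subrr.
move=> z; have [v <-] := @tpq_surj _ _ _ _ D z.
by rewrite -ee -!qu -dualm_comp dualm_zero ?mor0.
Qed.

(** A splitting of [T] gives an idempotent [e], which lifts to an idempotent of [M], hence to zero
    or the identity. Then [e] or its complement lifts to zero and vanishes by
    [lifts_idempotent_zero]. *)
Lemma transpose_indecomposable M T (D : transp M T) : star_zero M ->
  indecomposable M -> indecomposable T.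
Proof.
move=> M0 Mi; split=> [T0 | X Y /isoP/bip_dsum].
  case: (Mi) => Mn0 _; apply: Mn0 => x.
  exact: (lifts_zero M0 (lifts_id D) (fun t => T0 t) x).
case=> [i [p [j [q [ip jq qi pj ijE]]]]]; pose e := compm i p.
have [m ml] := lifts_exists D D e M0 M0.
have ee t : e (e t) = e t by rewrite /= ip.
have mm := lifts_unique M0 (lifts_comp ml ml) ml ee.
have [m0|m1] := idempotent_indec Mi mm.
  left=> x; rewrite -[x]ip; have /= := lifts_idempotent_zero ml ee m0 (i x).
  by rewrite ip => /(congr1 p); rewrite ip mor0.
right=> y; rewrite -[y]jq.
have e1 : subm (idm T) e (j y) = 0.
  apply: (lifts_idempotent_zero (lifts_sub (lifts_id D) ml)) => [t|x].
    by rewrite !submE /= !morB ip subrr subr0.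
  by rewrite submE m1 subrr.
by move: e1; rewrite submE /= pj mor0 subr0 => ->; rewrite mor0.
Qed.

Lemma is_transpose_transp M T : is_transpose M T -> exists D : transp M T, True.
Proof.
case=> p [q [qH qs qE]].
have eM x : mor_of_hom (mpp_aug_hom p) x = 0 <-> exists y, x = mor_of_hom (mpp_d_hom p) y.
  have e x' : (mpp_aug p x' == 0) = (x' \in limg (mpp_d p)).
    by rewrite mpp_exact memv_ker.
  split=> /= [/eqP | [y ->]].
    by rewrite e => /memv_imgP[y _ ->]; exists y.
  by apply/eqP; rewrite e memv_img ?memvf.
have eT f : mor_of_hom qH f = 0 <-> exists g, f = dualm (mor_of_hom (mpp_d_hom p)) g.
  rewrite -[mor_of_hom qH f]/(q f) qE; split=> -[g gE]; exists g.
    by apply: star_ext => x; rewrite dualmE gE comp_lfunE.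
  by apply/lfunP => x; rewrite gE dualmE comp_lfunE.
have min : superfluous (lker (linfun (mor_of_hom (mpp_d_hom p)))).
  have -> : linfun (mor_of_hom (mpp_d_hom p)) = mpp_d p by apply/lfunP => x; rewrite lfunE.
  exact: mpp_d_min.
have sa : surj (mor_of_hom (mpp_aug_hom p)) by apply: limg_surj (mpp_aug_surj p).
have sq : surj (mor_of_hom qH) by apply: limg_surj qs.
by exists (Transp (iffLR (projP _) (@mpp1_projective _ _ _ p))
  (iffLR (projP _) (@mpp0_projective _ _ _ p)) sa eM sq eT min).
Qed.

Lemma tau_rigid_transp M : tau_rigid M -> exists T (D : transp M T),
  forall (h : mor M (kdual T)) m, h m = 0.
Proof.
case=> N [T /is_transpose_transp[D _] /isoP[f [g [fK gK]]]] hom0.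
exists T, D => h m; rewrite -[h m]gK.
have : linfun (compm g h) \in homv M N by apply: homv_mor.
rewrite hom0 memv0 => /eqP/lfunP/(_ m); rewrite lfunE zero_lfunE /= => ->.
by rewrite mor0.
Qed.

Lemma Ext0_vanishes_mor M N (f : mor M N) : Ext_vanishes 0 M N -> forall x, f x = 0.
Proof.
move=> [P Pv] x; have [y <-] := limg_surj (pres_aug_surj P) x.
have /Pv : cocycle (linfun f \o pres_aug P)%VF.
  split; first apply/homvP => z a.
    by rewrite !comp_lfunE !lfunE /= (homvP _ (pres_aug_hom P)) mor_ract.
  apply/lfunP => z; rewrite !comp_lfunE zero_lfunE lfunE /=.
  have /eqP -> : pres_aug P (pres_d P 0 z) == 0.
    by rewrite -memv_ker -pres_exact0 memv_img ?memvf.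
  by rewrite mor0.
by move=> /= /lfunP/(_ y); rewrite comp_lfunE lfunE zero_lfunE.
Qed.

Lemma grade_star_zero M : grade_ge M 2 -> star_zero M.
Proof. by move=> /(_ 0%N isT) M0 f; apply: Ext0_vanishes_mor. Qed.

End TransposeFunctor.

Theorem corollary3p9 (K : closedFieldType) (A : falgType K)
  (A_basic : basic_algebra A)
  (A_connected : connected_algebra A)
  (A_auslander : auslander_algebra A)
  (fin_tilting :
     finitely_many_classes (fun T : rmod A => basic T /\ tilting T))
  (fin_tilting_op :
     finitely_many_classes (fun T : rmod A^c => basic T /\ tilting T))
  (pd2_grade2 : forall M : rmod A,
     indecomposable M -> tau_rigid M -> pd_eq M 2 -> of_grade2 M) :
  tau_tilting_finite A.
Proof.
have [n [X XE]] := finitely_many_rigid fin_tilting.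
have [m [Y YE]] := finitely_many_rigid fin_tilting_op.
(* [N] is any module with zero dual and transpose [Y k]; all such modules are isomorphic. If there
   is none, [zero_mod] is a dummy value. *)
have YX k : exists N : rmod A, forall M T (D : transp M T),
    star_zero M -> isom T (Y k) -> isom M N.
  have [[N [S [E [N0 SY]]]]|no] :=
      classic (exists N S (E : transp N S), star_zero N /\ isom S (Y k)).
    exists N => M T D M0 TY; apply: (transpose_reflects_isom D E) => //.
    exact: isom_trans (isom_sym SY).
  by exists zero_mod => M T D M0 TY; case: no; exists M, T, D.
have [Z ZE] := fin_all_exists YX.
(* The first [n] classes serve projective dimension at most one, the last [m] serve dimension
   two. *)
exists (n + m)%N, (fun k => match split k with inl i => X i | inr j => Z j end).
move=> M [Mi Mtau]; have [T [D hom0]] := tau_rigid_transp Mtau.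
have [M1|M1] := classic (pd_le M 1).
  have [|k Mk] := XE M; first by split=> //; [exact: pd_le_pd1 | exact: tau_rigid_ext1 hom0].
  by exists (unsplit (inl k)); rewrite unsplitK.
(* The upper bound is the global dimension of [A]; a bound 0 or 1 would contradict [M1]. *)
have /pd2_grade2[] // : pd_eq M 2.
  split; first by case: A_auslander.
  move=> [|[|k]] // Mk; case: M1 => //.
  by case: Mk => P P0; exists P => i i1; apply: P0; apply: ltnW.
move=> /grade_star_zero M0 _; have [|k Tk] := YE T.
  split; first exact: (transpose_indecomposable D).
    exact: (transpose_pd1 D).
  exact: (transpose_ext1 D M0 hom0).
by exists (unsplit (inr k)); rewrite unsplitK; apply/isoP/(ZE k M T D M0)/isoP.
Qed.
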